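(* Let $S = M_{11}$ be the Mathieu group of degree $11$. Then the following hold. (a) $\sigma(S) = 1/3$, and for $s \in S^\times$ one has $\sigma(S,s) = 1/3$ exactly when $s$ has order $11$. (b) For $s \in S$ of order $11$, $\mathcal{M}(S,s)$ consists of one group isomorphic to $L_2(11) = \mathrm{PSL}(2,11)$. (c) $P(S) = 1/3$, and for $s \in S^\times$ one has $P(S,s) = 1/3$ exactly when $s$ has order $11$. (d) Both the uniform spread and the spread of $S$ are exactly three, where for the uniform spread the class can be taken to consist of elements $s$ of order $11$.
   Context: For a finite nonabelian simple group $S$ let $S^\times = S \setminus \{1\}$. For $s \in S^\times$, $\mathcal{M}(S,s)$ is the set of all maximal subgroups of $S$ containing $s$. For $M \le S$, $1_M^S$ is the permutation character of $S$ on the right cosets of $M$. For $g \in S^\times$ set $\sigma(g,s) = \sum_{M \in \mathcal{M}(S,s)} 1_M^S(g)/1_M^S(1)$, $\sigma(S,s) = \max\{\sigma(g,s) : g \in S^\times\}$, $\sigma(S) = \min\{\sigma(S,s) : s \in S^\times\}$. Further $P(g,s) = |\{h \in S : \langle s^h, g\rangle \neq S\}|/|S|$, $P(S,s) = \max\{P(g,s) : g \in S^\times\}$, $P(S) = \min\{P(S,s) : s \in S^\times\}$. $S$ has spread at least $k$ if for any $g_1,\ldots,g_k \in S^\times$ there is $s \in S$ with $\langle g_i, s\rangle = S$ for $1 \le i \le k$; it has uniform spread at least $k$ if there is a fixed conjugacy class $C$ of $S$ such that $s$ can always be chosen in $C$. The (uniform) spread is exactly $k$ if it is at least $k$ but not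 at least $k+1$. *)

(* Defs.v *)
From HB Require Import structures.
From mathcomp Require Import all_boot all_order all_algebra all_fingroup.
From mathcomp Require Import all_solvable.

Set Implicit Arguments.
Unset Strict Implicit.
Unset Printing Implicit Defensive.

Import Order.TTheory GRing.Theory Num.Theory.
Local Open Scope group_scope.

(* The value 0 on the empty set is a convention that is never used below: all
   extrema are taken over S^#, which is nonempty for a nontrivial group S. *)
Definition maxval (T : finType) (A : {set T}) (f : T -> rat) : rat :=
  if [pick x in A] is Some x0 then \big[Order.max/f x0]_(x in A) f x else 0%R.

Definition minval (T : finType) (A : {set T}) (f : T -> rat) : rat :=
  if [pick x in A] is Some x0 then \big[Order.min/f x0]_(x in A) f x else 0%R.

Lemma maxvalP (T : finType) (A : {set T}) (f : T -> rat) :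
  A != set0 ->
  (exists2 x, x \in A & maxval A f = f x) /\
  (forall x, x \in A -> (f x <= maxval A f)%R).
Proof.
case/set0Pn=> a Aa; rewrite /maxval; case: pickP => [x0 Ax0 | /(_ a)]; last first.
  by rewrite Aa.
split=> [|x Ax]; last exact: le_bigmax_cond.
apply: (big_ind (fun v => exists2 x, x \in A & v = f x)).
- by exists x0.
- by move=> _ _ [x Ax ->] [y Ay ->]; case: leP => _; [exists y | exists x].
- by move=> x Ax; exists x.
Qed.

Lemma minvalP (T : finType) (A : {set T}) (f : T -> rat) :
  A != set0 ->
  (exists2 x, x \in A & minval A f = f x) /\
  (forall x, x \in A -> (minval A f <= f x)%R).
Proof.
case/set0Pn=> a Aa; rewrite /minval; case: pickP => [x0 Ax0 | /(_ a)]; last first.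
  by rewrite Aa.
split=> [|x Ax]; last exact: bigmin_le_cond.
apply: (big_ind (fun v => exists2 x, x \in A & v = f x)).
- by exists x0.
- by move=> _ _ [x Ax ->] [y Ay ->]; case: leP => _; [exists x | exists y].
- by move=> x Ax; exists x.
Qed.

Section Generation.

Variables (gT : finGroupType) (S : {group gT}).
Implicit Types (M : {group gT}) (g s : gT) (k : nat).

Definition max_over s : {set {group gT}} :=
  [set M : {group gT} | maximal M S & s \in M].

(* 1_M^S(g): the number of right cosets of M in S fixed by right
   multiplication by g *)
Definition perm_char M g : nat := #|'Fix_(rcosets M S | 'Rs)[g]|.

Definition sigma_elt g s : rat :=
  (\sum_(M in max_over s) (perm_char M g)%:R / (perm_char M 1%g)%:R)%R.
Definition sigma_at s : rat := maxval S^# (fun g => sigma_elt g s).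
Definition sigma : rat := minval S^# sigma_at.

Definition P_elt g s : rat :=
  (#|[set h in S | (<<[set s ^ h; g]>> != S)%g]|%:R / #|S|%:R)%R.
Definition P_at s : rat := maxval S^# (fun g => P_elt g s).
Definition P : rat := minval S^# P_at.

Definition spread_within (C : {set gT}) k : Prop :=
  forall g : 'I_k -> gT, (forall i, g i \in S^#) ->
  exists2 s, s \in C & forall i, <<[set g i; s]>> = S.

Definition spread_at_least k : Prop := spread_within S k.

Definition uniform_spread_at_least k : Prop :=
  exists2 C : {set gT}, C \in classes S & spread_within C k.

Definition spread_exactly k : Prop :=
  spread_at_least k /\ ~ spread_at_least k.+1.

Definition uniform_spread_exactly k : Prop :=
  uniform_spread_at_least k /\ ~ uniform_spread_at_least k.+1.

End Generation.

(* The cycle (x y_1 ... y_r), for distinct x, y_1, ..., y_r; permutation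
   products are read from left to right. *)
Definition cyc (T : finType) (x : T) (ys : seq T) : {perm T} :=
  \prod_(y <- ys) tperm x y.

(* The usual generators (1,2,...,11) and (3,7,11,8)(4,10,5,6) of M_11 in its
   4-transitive action on 11 points, with the points renumbered 0, ..., 10 as
   the integers modulo 11. *)
Definition M11_a : {perm 'Z_11} := perm (addIr (1%R : 'Z_11)).
Definition M11_b : {perm 'Z_11} :=
  cyc (2%R : 'Z_11) [:: 6; 10; 7]%R * cyc (3%R : 'Z_11) [:: 9; 4; 5]%R.

Definition M11 : {group {perm 'Z_11}} := <<[set M11_a; M11_b]>>%G.

(* {'GL_n[F]} is the type of invertible matrices of size n.-1.+1, which is n
   for positive n. *)
Definition SL (n : nat) (F : finFieldType) : {set {'GL_n[F]}} :=
  [set A : {'GL_n[F]} | (\det (GLval A) == 1)%R].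

Lemma SL_group_set (n : nat) (F : finFieldType) : group_set (SL n F).
Proof.
apply/group_setP; split=> [|A B]; first by rewrite inE GL_1E det1.
by rewrite !inE GL_ME det_mulmx => /eqP-> /eqP->; rewrite mulr1.
Qed.

Canonical SL_group (n : nat) (F : finFieldType) : {group {'GL_n[F]}} := Group (SL_group_set n F).

Definition PSL (n : nat) (F : finFieldType) : {group coset_of 'Z(SL n F)} :=
  (SL n F / 'Z(SL n F))%G.

(* Main.v *)
(** M11 acts on 11 points and on the 12 cosets of a subgroup L11 = <a, b^2>, the
    image of an explicit homomorphism from SL(2, 11) with kernel the centre. An
    element of M11 is recorded by the pair of permutations it induces, and a chain
    of point stabilizers turns M11 into a list of 7920 such pairs, over which the
    remaining finite facts are computed.

    Any x in M11 outside L11 generates M11 together with a, so by Sylow an element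
    s of order 11 lies in a single maximal subgroup, a conjugate of L11; hence
    P(g, s) = sigma(g, s) is 1/12 of the number of cosets of L11 fixed by g, at
    most 4/12. Every other s shares a fixed coset, or a fixed point or an invariant
    pair, with conjugates of the involution t = b^2 often enough to force
    P(t, s) > 1/3, and sigma >= P. The spread is at least 3 because no three fixed
    sets of nontrivial elements cover the 12 cosets. It is not 4: there are three
    involutions and an element of order 3 such that every s in M11 has, together
    with one of them, a common fixed coset or a common invariant set of at most
    three points. *)
From HB Require Import structures.
Require Import Defs.
From mathcomp Require Import all_boot all_order all_algebra all_fingroup.
From mathcomp Require Import all_solvable.

Set Implicit Arguments.
Unset Strict Implicit.
Unset Printing Implicit Defensive.

Import Order.TTheory GRing.Theory Num.Theory.
Local Open Scope group_scope.

(** * Fixed cosets, maximal subgroups and generation *)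

Section Generation.

Variables (gT : finGroupType) (S : {group gT}).
Implicit Types (M : {group gT}) (g s h : gT).

(** The coset Mh is fixed by g exactly when g lies in M^h, so the elements h counted here fill up
    the fixed cosets, each of size |M|. *)
Lemma card_conj_mem M g : M \subset S -> g \in S ->
  #|[set h in S | g \in M :^ h]| = (perm_char S M g * #|M|)%N.
Proof.
move=> sMS Sg; apply: card_uniform_partition => [A|].
  by rewrite inE => /andP[/rcosetsP[x _ ->] _]; rewrite card_rcoset.
have /and3P[_ tiP P0] := rcosets_partition sMS.
have fixE x : (M :* x :* g == M :* x) = (g \in M :^ x).
  rewrite -rcosetM mem_conjg conjgE invgK.
  by apply/eqP/idP => [/rcoset_eqP|]; rewrite ?mem_rcoset -?mulgA // => ?;
     apply/rcoset_eqP; rewrite mem_rcoset -?mulgA.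
apply/and3P; split.
- apply/eqP/setP=> x; rewrite inE; apply/bigcupP/andP.
  + case=> A; rewrite inE => /andP[/rcosetsP[y Sy ->]].
    rewrite inE sub1set inE /= rcosetE => fix_y /rcosetP[m Mm ->].
    split; first by rewrite groupM // (subsetP sMS).
    by rewrite -fixE rcosetM (rcoset_id Mm).
  + case=> Sx gMx; exists (M :* x); last exact: rcoset_refl.
    by rewrite inE mem_rcosets mulSGid // Sx inE sub1set inE /= rcosetE fixE.
- by apply: trivIsetS tiP; apply/subsetP=> A /setIP[].
- by apply: contra P0 => /setIP[].
Qed.

Lemma perm_char1 M : perm_char S M 1 = #|S : M|.
Proof.
rewrite /perm_char; congr #|pred_of_set _|; apply/setIidPl/subsetP=> A _.
by apply/afix1P; rewrite act1.
Qed.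

(** Each term of sigma becomes the probability that g lies in a random conjugate of M; this makes
    sigma comparable with P. *)
Lemma perm_char_ratio M g : M \subset S -> g \in S ->
  ((perm_char S M g)%:R / (perm_char S M 1)%:R
     = #|[set h in S | g \in M :^ h]|%:R / #|S|%:R :> rat)%R.
Proof.
move=> sMS Sg; rewrite card_conj_mem // perm_char1 -(Lagrange sMS) mulnC !natrM.
by rewrite -mulf_div divff ?mul1r // pnatr_eq0 -lt0n.
Qed.

Lemma nongen_maximal s g : s \in S -> g \in S -> <<[set s; g]>> != S ->
  exists2 M, M \in max_over S s & g \in M.
Proof.
move=> Ss Sg neS; have sS: <<[set s; g]>> \subset S.
  by rewrite gen_subG subUset !sub1set Ss.
have [/eqP eqS|[M maxM sM]] := maximal_exists sS; first by rewrite eqS in neS.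
by exists M; rewrite ?inE ?maxM ?(subsetP sM) ?mem_gen ?set21 ?set22.
Qed.

Lemma sub_nongen (M : {group gT}) s g :
  M \proper S -> s \in M -> g \in M -> <<[set s; g]>> != S.
Proof.
move=> ltMS Ms Mg; apply: contraTneq ltMS => <-.
by rewrite properE gen_subG subUset !sub1set Ms Mg andbF.
Qed.

Lemma maximalJ_in M h : h \in S -> maximal (M :^ h) S = maximal M S.
Proof. by move=> Sh; rewrite -{1}(conjGid Sh) maximalJ. Qed.

Lemma max_overJ M s h : h \in S ->
  ((M :^ h)%G \in max_over S (s ^ h)) = (M \in max_over S s).
Proof. by move=> Sh; rewrite !inE maximalJ_in //= memJ_conjg. Qed.

Lemma max_over_conj s h : h \in S ->
  max_over S (s ^ h) = [set (M :^ h)%G | M in max_over S s].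
Proof.
move=> Sh; apply/setP=> M.
apply/idP/imsetP=> [maxM|[K maxK ->]]; last by rewrite max_overJ.
have eM : M = ((M :^ h^-1) :^ h)%G by apply: val_inj; rewrite /= conjsgKV.
by exists (M :^ h^-1)%G; rewrite // -(max_overJ _ _ Sh) -eM.
Qed.

Lemma eq_max_over s t : <[s]> = <[t]> -> max_over S s = max_over S t.
Proof. by move=> e; apply/setP=> M; rewrite !inE -!cycle_subG e. Qed.

Lemma nongenJ_maximal s g h : s \in S -> g \in S -> h \in S ->
  <<[set s ^ h; g]>> != S -> exists2 M, M \in max_over S s & g \in M :^ h.
Proof.
move=> Ss Sg Sh neS.
have [|M maxM Mg] := nongen_maximal _ Sg neS; first by rewrite groupJ.
exists (M :^ h^-1)%G; last by rewrite conjsgKV.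
by rewrite -(max_overJ _ _ Sh) (_ : _ :^ _ = M)%G //; apply: val_inj; rewrite /= conjsgKV.
Qed.

(** A proper subgroup containing [s ^ h] lies in a maximal one, and the only candidate is the
    conjugate of M by h. *)
Lemma nongen_unique_maximal M s g h : max_over S s = [set M] ->
    s \in S -> g \in S -> h \in S ->
  (<<[set s ^ h; g]>> != S) = (g \in M :^ h).
Proof.
move=> maxs Ss Sg Sh; apply/idP/idP.
  by case/nongenJ_maximal=> // K; rewrite maxs => /set1P->.
have : M \in max_over S s by rewrite maxs set11.
rewrite inE => /andP[maxM Ms] Mg.
apply: (@sub_nongen (M :^ h)%G); rewrite ?memJ_conjg //.
by rewrite -{1}(maximalJ_in _ Sh) in maxM; exact: maxgroupp maxM.
Qed.

Lemma P_elt_unique_maximal M s g : max_over S s = [set M] ->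
    s \in S -> g \in S ->
  P_elt S g s = ((perm_char S M g)%:R / #|S : M|%:R)%R.
Proof.
move=> maxs Ss Sg; have : M \in max_over S s by rewrite maxs set11.
rewrite inE => /andP[/maxgroupp/proper_sub sMS _].
rewrite -perm_char1 perm_char_ratio // /P_elt; congr (_%:R / _)%R.
apply: eq_card => h; rewrite !inE; case: (boolP (h \in S)) => //= Sh.
exact: nongen_unique_maximal.
Qed.

Lemma sigma_elt_unique_maximal M s g : max_over S s = [set M] ->
  sigma_elt S g s = ((perm_char S M g)%:R / #|S : M|%:R)%R.
Proof. by move=> maxs; rewrite /sigma_elt maxs big_set1 perm_char1. Qed.

(** Union bound: if [s ^ h] and g fail to generate S, then g lies in M^h for some maximal M
    containing s. *)
Lemma P_le_sigma s g : s \in S -> g \in S -> (P_elt S g s <= sigma_elt S g s)%R.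
Proof.
move=> Ss Sg; rewrite /sigma_elt (eq_bigr (fun M : {group gT} =>
  #|[set h in S | g \in M :^ h]|%:R / #|S|%:R)%R) => [|M]; last first.
  by rewrite inE => /andP[/maxgroupp/proper_sub sMS _]; rewrite perm_char_ratio.
rewrite -mulr_suml -natr_sum ler_wpM2r ?invr_ge0 ?ler0n // ler_nat.
apply: leq_trans (_ : #|\bigcup_(M in max_over S s) [set h in S | g \in M :^ h]| <= _).
  apply/subset_leq_card/subsetP=> h; rewrite inE => /andP[Sh].
  case/nongenJ_maximal=> // M maxM Mg.
  by apply/bigcupP; exists M => //; rewrite inE Sh.
elim/big_rec2: _ => [|M m A _ leAm]; first by rewrite cards0.
by apply: leq_trans (leq_card_setU _ _) _; rewrite leq_add2l.
Qed.

(** Left translation by k carries one set of bad elements onto the other. *)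
Lemma P_eltJ s g k : k \in S -> P_elt S g (s ^ k) = P_elt S g s.
Proof.
move=> Sk; rewrite /P_elt; congr (_%:R / _)%R.
rewrite -(card_imset _ (mulgI k)); apply: eq_card => h.
apply/imsetP/idP => [[x]|]; rewrite inE.
  by case/andP=> Sx genx ->; rewrite inE groupM //= conjgM.
case/andP=> Sh genh; exists (k^-1 * h); rewrite ?mulKVg //.
by rewrite inE groupM ?groupV //= -conjgM mulKVg.
Qed.

Lemma spread_withinS (C D : {set gT}) k :
  C \subset D -> spread_within S C k -> spread_within S D k.
Proof.
by move=> /subsetP sCD spC g /spC[s Cs gen_s]; exists s => //; apply: sCD.
Qed.

Lemma spread_of_uniform k : uniform_spread_at_least S k -> spread_at_least S k.
Proof.
case=> _ /imsetP[s Ss ->]; apply: spread_withinS.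
by apply/subsetP=> _ /imsetP[x Sx ->]; rewrite groupJ.
Qed.

End Generation.

(** * Permutations of the 11 points as lists of images *)

Local Notation pt := 'Z_11.

Definition lmul (l m : seq nat) := [seq nth 0 m i | i <- l].
Definition lone := iota 0 11.
Definition lpow (l : seq nat) k := iter k (fun m => lmul m l) lone.

Definition codes (l : seq nat) (x : {perm pt}) :=
  size l = 11 /\ forall i : pt, x i = nth 0 l i :> nat.

Lemma codes_inj l x y : codes l x -> codes l y -> x = y.
Proof.
by case=> _ lx [_ ly]; apply/permP=> i; apply: val_inj; rewrite /= lx ly.
Qed.

Lemma codes_uniq l m x : codes l x -> codes m x -> l = m.
Proof.
case=> szl lx [szm mx]; apply: (@eq_from_nth _ 0) => [|i]; rewrite szl ?szm // => lti.
by rewrite -(lx (Ordinal lti)) mx.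
Qed.

Lemma codes1 : codes lone 1.
Proof. by split=> // i; rewrite perm1 nth_iota //; apply: ltn_ord. Qed.

Lemma codesM l m x y : codes l x -> codes m y -> codes (lmul l m) (x * y).
Proof.
case=> szl lx [szm my]; split=> [|i]; first by rewrite size_map.
by rewrite permM my lx (nth_map 0) // szl; apply: ltn_ord.
Qed.

Lemma codesX l x k : codes l x -> codes (lpow l k) (x ^+ k).
Proof.
move=> lx; elim: k => [|k IHk]; first exact: codes1.
by rewrite expgSr; apply: codesM.
Qed.

Definition la := [:: 1; 2; 3; 4; 5; 6; 7; 8; 9; 10; 0]%N.
Definition lb := [:: 0; 1; 6; 9; 5; 3; 10; 2; 8; 4; 7]%N.

Lemma codes_a : codes la M11_a.
Proof.
split=> // i; rewrite permE; case: i => i lti.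
by do 11?[case: i lti => [//|i] lti].
Qed.

Lemma codes_b : codes lb M11_b.
Proof.
split=> // i; rewrite /M11_b /cyc !big_cons !big_nil !mulg1 !permM /tperm !permE.
by case: i => i lti; do 11?[case: i lti => [//|i] lti].
Qed.

Lemma M11a_in : M11_a \in M11. Proof. by rewrite mem_gen ?set21. Qed.
Lemma M11b_in : M11_b \in M11. Proof. by rewrite mem_gen ?set22. Qed.

(* [v] will be the image of the lower unitriangular generator of SL(2, 11). *)
Definition M11_v := M11_b ^+ 2 * M11_a ^+ 2.
Definition lv := lmul (lpow lb 2) (lpow la 2).
Lemma codes_v : codes lv M11_v.
Proof. by apply: codesM; apply: codesX; [apply: codes_b | apply: codes_a]. Qed.

Lemma M11v_in : M11_v \in M11.
Proof. by rewrite groupM ?groupX ?M11a_in ?M11b_in. Qed.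

(** * The homomorphism from SL(2, 11) to M11 *)

Record quad := Quad { qa : nat; qb : nat; qc : nat; qd : nat }.
Arguments Quad (_ _ _ _)%_N.

Definition quad_seq q := [:: qa q; qb q; qc q; qd q].
Definition quad_of s := Quad (nth 0 s 0) (nth 0 s 1%N) (nth 0 s 2) (nth 0 s 3).
Lemma quad_seqK : cancel quad_seq quad_of. Proof. by case. Qed.
HB.instance Definition _ := Equality.copy quad (can_type quad_seqK).

Definition quad1 := Quad 1 0 0 1.
Definition quadN1 := Quad 10 0 0 10.
(** Right (r) and left (l) multiplication by U = [[1, 1], [0, 1]] and V = [[1, 0], [1, 1]]. *)
Definition quad_rU q := Quad (qa q) ((qa q + qb q) %% 11) (qc q) ((qc q + qd q) %% 11).
Definition quad_rV q := Quad ((qa q + qb q) %% 11) (qb q) ((qc q + qd q) %% 11) (qd q).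
Definition quad_lU q := Quad ((qa q + qc q) %% 11) ((qb q + qd q) %% 11) (qc q) (qd q).
Definition quad_lV q := Quad (qa q) (qb q) ((qa q + qc q) %% 11) ((qb q + qd q) %% 11).

Definition quads := [seq q <- [seq Quad ab.1 ab.2 cd.1 cd.2 |
    ab <- [seq (a, b) | a <- iota 0 11, b <- iota 0 11],
    cd <- [seq (c, d) | c <- iota 0 11, d <- iota 0 11]]
  | (qa q * qd q) %% 11 == (qb q * qc q + 1)%N %% 11].

Lemma size_quads : size quads = 1320.
Proof. by vm_compute. Qed.

Definition inv11 := nth 0 [:: 0; 1; 6; 4; 3; 9; 2; 8; 7; 5; 10]%N.

(* For c != 0 the matrix [[a, b], [c, d]] of determinant 1 is U^x V^c U^y with
   x = (a - 1) / c and y = (d - 1) / c. *)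
Definition qx q := ((qa q + 10) * inv11 (qc q))%N %% 11.
Definition qy q := ((qd q + 10) * inv11 (qc q))%N %% 11.

Definition uvu_perm x c y : {perm pt} := M11_a ^+ x * M11_v ^+ c * M11_a ^+ y.
(** If c = 0 then d is nonzero, so right multiplication by V makes the lower left entry nonzero; the
    factor [M11_v ^+ 10] undoes it. *)
Definition quad_perm q : {perm pt} :=
  if qc q == 0 then
    let q' := quad_rV q in uvu_perm (qx q') (qc q') (qy q') * M11_v ^+ 10
  else uvu_perm (qx q) (qc q) (qy q).

Definition lapows := mkseq (lpow la) 11.
Definition lvpows := mkseq (lpow lv) 11.
Definition luvu x c y :=
  lmul (lmul (nth [::] lapows x) (nth [::] lvpows c)) (nth [::] lapows y).
Definition lquad q :=
  if qc q == 0 then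
    let q' := quad_rV q in lmul (luvu (qx q') (qc q') (qy q')) (nth [::] lvpows 10)
  else luvu (qx q) (qc q) (qy q).

Lemma codes_uvu x c y : x < 11 -> c < 11 -> y < 11 ->
  codes (luvu x c y) (uvu_perm x c y).
Proof.
move=> ltx ltc lty; rewrite /luvu !nth_mkseq //.
by do ?apply: codesM; apply: codesX; [apply: codes_a | apply: codes_v | apply: codes_a].
Qed.

Lemma codes_quad q : q \in quads -> codes (lquad q) (quad_perm q).
Proof.
move=> Qq; have ltc: qc q < 11.
  by apply/(@allP _ (fun q => qc q < 11)): q Qq; vm_compute.
rewrite /lquad /quad_perm; case: ifP => _; last by apply: codes_uvu; rewrite ?ltn_mod.
apply: codesM; first by apply: codes_uvu; rewrite ?ltn_mod.
by rewrite nth_mkseq //; apply/codesX/codes_v.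
Qed.

(** In order: compatibility with right multiplication by U and by V, generation of SL(2, 11) by U
    and V, the kernel lying in {1, -1}, and the centre lying in {1, -1}. *)
Definition quad_checks q :=
  [&& lquad (quad_rU q) == lmul (lquad q) la,
      lquad (quad_rV q) == lmul (lquad q) lv,
      if qc q == 0 then qc (quad_rV q) != 0 else
        iter (qy q) quad_rU (iter (qc q) quad_rV (iter (qx q) quad_rU quad1)) == q,
      (lquad q == lone) ==> (q \in [:: quad1; quadN1]) &
      (quad_rU q == quad_lU q) && (quad_rV q == quad_lV q) ==>
        (q \in [:: quad1; quadN1])].

Lemma quad_checksP q : q \in quads -> quad_checks q.
Proof. by apply/allP: q; lazy. Qed.

(** * Coding SL(2, 11) by quadruples *)

Section FromSL2.

Local Notation G := {'GL_2['F_11]}.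
Local Notation SL2 := (SL 2 'F_11).

Definition quad_GL (g : G) : quad :=
  Quad (val (GLval g 0 0)%R) (val (GLval g 0 1)%R)
       (val (GLval g 1 0)%R) (val (GLval g 1 1)%R).

Lemma ord2E (P : 'I_2 -> Prop) : P 0%R -> P 1%R -> forall i, P i.
Proof.
move=> P0 P1 [[|[|//]] lti]; first by rewrite (_ : Ordinal _ = 0%R) //; apply: val_inj.
by rewrite (_ : Ordinal _ = 1%R) //; apply: val_inj.
Qed.

Lemma quad_GL_inj : injective quad_GL.
Proof.
move=> g h [e00 e01 e10 e11]; apply: val_inj; apply/matrixP.
by do 2![elim/ord2E]; apply: val_inj.
Qed.

Lemma det2E (A : 'M['F_11]_2) :
  (\det A = A 0 0 * A 1 1 - A 0 1 * A 1 0)%R.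
Proof.
rewrite (expand_det_row _ 0%R) !big_ord_recl big_ord0 /cofactor !det_mx11 !mxE addr0.
rewrite /= expr0 mul1r expr1 mulN1r mulrN.
by congr (_ * A _ _ - A _ _ * A _ _)%R; apply: val_inj.
Qed.

Definition transvU : 'M['F_11]_2 := (\matrix_(i, j) (i <= j)%N%:R)%R.

Lemma transvU_unit : transvU \is a GRing.unit.
Proof. by rewrite unitmxE det2E !mxE. Qed.
Lemma transvV_unit : (transvU^T)%R \is a GRing.unit.
Proof. by rewrite unitmx_tr transvU_unit. Qed.

Definition glU : G := FinRing.Unit transvU_unit.
Definition glV : G := FinRing.Unit transvV_unit.

Lemma glU_SL : glU \in SL2. Proof. by rewrite inE /= det2E !mxE. Qed.
Lemma glV_SL : glV \in SL2. Proof. by rewrite inE /= det_tr det2E !mxE. Qed.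

Lemma val_addF (x y : 'F_11) : val (x + y)%R = (val x + val y) %% 11.
Proof. by []. Qed.
Lemma val_mulF (x y : 'F_11) : val (x * y)%R = (val x * val y) %% 11.
Proof. by []. Qed.

Lemma GL_mulE (g h : G) i j :
  (GLval (g * h)%g i j = GLval g i 0 * GLval h 0 j + GLval g i 1 * GLval h 1 j)%R.
Proof.
rewrite GL_ME mxE !big_ord_recl big_ord0 addr0.
by congr (_ + GLval g _ _ * GLval h _ _)%R; apply: val_inj.
Qed.

Lemma glUE :
  ((GLval glU 0 0 = 1)%R * (GLval glU 0 1 = 1)%R *
   (GLval glU 1 0 = 0)%R * (GLval glU 1 1 = 1)%R)%type.
Proof. by rewrite !mxE. Qed.

Lemma glVE :
  ((GLval glV 0 0 = 1)%R * (GLval glV 0 1 = 0)%R *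
   (GLval glV 1 0 = 1)%R * (GLval glV 1 1 = 1)%R)%type.
Proof. by rewrite !mxE. Qed.

Lemma quad_mulU g : quad_GL (g * glU) = quad_rU (quad_GL g).
Proof. by rewrite /quad_GL !GL_mulE !glUE !mulr0 !mulr1 !addr0. Qed.

Lemma quad_mulV g : quad_GL (g * glV) = quad_rV (quad_GL g).
Proof. by rewrite /quad_GL !GL_mulE !glVE !mulr0 !mulr1 !add0r. Qed.

Lemma quad_Umul g : quad_GL (glU * g) = quad_lU (quad_GL g).
Proof. by rewrite /quad_GL !GL_mulE !glUE !mul0r !mul1r !add0r. Qed.

Lemma quad_Vmul g : quad_GL (glV * g) = quad_lV (quad_GL g).
Proof. by rewrite /quad_GL !GL_mulE !glVE !mul0r !mul1r !addr0. Qed.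

Lemma quad_one : quad_GL 1 = quad1.
Proof. by rewrite /quad_GL GL_1E !mxE. Qed.

Lemma quad_in_quads g : g \in SL2 -> quad_GL g \in quads.
Proof.
rewrite inE det2E subr_eq => /eqP detg; rewrite mem_filter; apply/andP; split.
  have e := congr1 val detg; rewrite val_mulF val_addF val_mulF in e.
  by apply/eqP; apply: etrans e _; rewrite addnC; apply: modnDml.
have mem11 (x : 'F_11) : val x \in iota 0 11 by rewrite mem_iota; apply: ltn_ord.
apply/allpairsP; exists ((val (GLval g 0 0), val (GLval g 0 1)),
  (val (GLval g 1 0), val (GLval g 1 1)))%R.
by split=> //; apply: allpairs_f.
Qed.

End FromSL2.

(** * The homomorphism and its kernel, for an abstract group coded by quadruples *)

Section Morphism.

Variables (gT : finGroupType) (SL2 : {group gT}) (glU glV : gT) (quad_GL : gT -> quad).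
Hypothesis quad_GL_inj : injective quad_GL.
Hypothesis quad_in_quads : forall g, g \in SL2 -> quad_GL g \in quads.
Hypothesis glU_SL : glU \in SL2.
Hypothesis glV_SL : glV \in SL2.
Hypothesis quad_one : quad_GL 1 = quad1.
Hypothesis quad_mulU : forall g, quad_GL (g * glU) = quad_rU (quad_GL g).
Hypothesis quad_mulV : forall g, quad_GL (g * glV) = quad_rV (quad_GL g).
Hypothesis quad_Umul : forall g, quad_GL (glU * g) = quad_lU (quad_GL g).
Hypothesis quad_Vmul : forall g, quad_GL (glV * g) = quad_lV (quad_GL g).

Definition sl2_perm (g : gT) : {perm pt} := quad_perm (quad_GL g).

Lemma codes_sl2 g : g \in SL2 -> codes (lquad (quad_GL g)) (sl2_perm g).
Proof. by move=> Gg; apply/codes_quad/quad_in_quads. Qed.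

Lemma sl2_perm1 : sl2_perm 1 = 1.
Proof.
apply: codes_inj codes1.
have <- : lquad (quad_GL 1) = lone by rewrite quad_one; vm_compute.
exact/codes_sl2/group1.
Qed.

Lemma sl2_permMU g : g \in SL2 -> sl2_perm (g * glU) = sl2_perm g * M11_a.
Proof.
move=> Gg; have /and5P[/eqP e _ _ _ _] := quad_checksP (quad_in_quads Gg).
apply: codes_inj (codesM (codes_sl2 Gg) codes_a); rewrite -e -quad_mulU.
by apply/codes_sl2/groupM/glU_SL.
Qed.

Lemma sl2_permMV g : g \in SL2 -> sl2_perm (g * glV) = sl2_perm g * M11_v.
Proof.
move=> Gg; have /and5P[_ /eqP e _ _ _] := quad_checksP (quad_in_quads Gg).
apply: codes_inj (codesM (codes_sl2 Gg) codes_v); rewrite -e -quad_mulV.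
by apply/codes_sl2/groupM/glV_SL.
Qed.

Lemma sl2_permU : sl2_perm glU = M11_a.
Proof. by rewrite -[glU]mul1g sl2_permMU // sl2_perm1 mul1g. Qed.

Lemma sl2_permV : sl2_perm glV = M11_v.
Proof. by rewrite -[glV]mul1g sl2_permMV // sl2_perm1 mul1g. Qed.

Lemma quad_mulUX g k : quad_GL (g * glU ^+ k) = iter k quad_rU (quad_GL g).
Proof. by elim: k => [|k IHk]; rewrite ?mulg1 // expgSr mulgA quad_mulU IHk. Qed.

Lemma quad_mulVX g k : quad_GL (g * glV ^+ k) = iter k quad_rV (quad_GL g).
Proof. by elim: k => [|k IHk]; rewrite ?mulg1 // expgSr mulgA quad_mulV IHk. Qed.

(** An element with c nonzero is U^x V^c U^y by the third check; one with c = 0 becomes such after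
    multiplication by V. *)
Lemma SL2_gen : <<[set glU; glV]>> = SL2.
Proof.
apply/eqP; rewrite eqEsubset gen_subG subUset !sub1set glU_SL glV_SL /=.
have [KU KV]: glU \in <<[set glU; glV]>> /\ glV \in <<[set glU; glV]>>.
  by rewrite !mem_gen ?set21 ?set22.
have memK g : g \in SL2 -> qc (quad_GL g) != 0 -> g \in <<[set glU; glV]>>.
  move=> Gg nz; have /and5P[_ _ + _ _] := quad_checksP (quad_in_quads Gg).
  rewrite (negPf nz) -quad_one -quad_mulUX -quad_mulVX -quad_mulUX.
  by move/eqP/quad_GL_inj <-; rewrite !groupM ?groupX.
apply/subsetP=> g Gg; have [q0|] := eqVneq (qc (quad_GL g)) 0; last exact: memK.
have /and5P[_ _ + _ _] := quad_checksP (quad_in_quads Gg).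
rewrite q0 eqxx -quad_mulV => nz; rewrite -[g](mulgK glV) groupM ?groupV //.
by apply: memK nz; rewrite groupM ?glV_SL.
Qed.

(** The right factors h that [sl2_perm] respects, for every left factor, form a group; it contains U
    and V, hence is everything. *)
Lemma sl2_permM : {in SL2 &, {morph sl2_perm : x y / x * y}}.
Proof.
pose T := [set h in SL2 | [forall g in SL2, sl2_perm (g * h) == sl2_perm g * sl2_perm h]].
have TP h : reflect (h \in SL2 /\ forall g, g \in SL2 ->
    sl2_perm (g * h) = sl2_perm g * sl2_perm h) (h \in T).
  rewrite inE; apply: (iffP andP) => -[Gh fh]; split=> //.
    by move=> g Gg; apply/eqP/(forall_inP fh).
  by apply/forall_inP=> g /fh->.
have gsT : group_set T.
  apply/group_setP; split=> [|x y /TP[Gx fx] /TP[Gy fy]].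
    by apply/TP; split=> // g _; rewrite mulg1 sl2_perm1 mulg1.
  apply/TP; split=> [|g Gg]; first exact: groupM.
  by rewrite mulgA !fy ?groupM // fx // mulgA.
have sT : SL2 \subset T.
  rewrite -SL2_gen -[T]/(gval (Group gsT)) gen_subG subUset !sub1set.
  apply/andP; split; apply/TP; split; rewrite ?glU_SL ?glV_SL // => g Gg.
    by rewrite sl2_permMU ?sl2_permU.
  by rewrite sl2_permMV ?sl2_permV.
by move=> x y Gx /(subsetP sT)/TP[_]; apply.
Qed.

Canonical sl2_morphism := Morphism sl2_permM.

(** For k = 10 the factor U V^(-1) U is the Weyl element [[0, 1], [-1, 0]], whose square is -1. *)
Definition gl_uvu2 k : gT := glU * glV ^+ k * glU * (glU * glV ^+ k * glU).
Definition glN1 := gl_uvu2 10.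

Lemma quad_glN1 : quad_GL glN1 = quadN1.
Proof.
(* The exponent stays abstract during the rewriting and becomes 10 again only for the final
   evaluation. *)
rewrite /glN1; move: {-1}10 (erefl 10) => k k10.
rewrite /gl_uvu2 !mulgA quad_mulU quad_mulVX !quad_mulU.
by rewrite quad_mulVX -[glU]mul1g quad_mulU quad_one -k10.
Qed.

Lemma glN1_SL : glN1 \in SL2.
Proof. by rewrite !groupM ?groupX ?glU_SL ?glV_SL. Qed.

Lemma mem_quadN1 g : (quad_GL g \in [:: quad1; quadN1]) = (g \in [set 1; glN1]).
Proof.
by rewrite !inE -quad_one -quad_glN1 !(inj_eq quad_GL_inj).
Qed.

Lemma center_SL2 : 'Z(SL2) = [set 1; glN1].
Proof.
apply/setP=> g; apply/idP/idP=> [/centerP[Gg cg]|].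
  have /and5P[_ _ _ _ /implyP] := quad_checksP (quad_in_quads Gg).
  rewrite mem_quadN1; apply; rewrite -quad_mulU -quad_mulV -quad_Umul -quad_Vmul.
  by rewrite !cg ?glU_SL ?glV_SL ?eqxx.
rewrite !inE => /orP[]/eqP->; first by rewrite group1 group1.
rewrite glN1_SL -SL2_gen cent_gen; apply/centP=> h; rewrite !inE.
case/orP=> /eqP-> ; apply: quad_GL_inj.
  by rewrite quad_mulU quad_Umul quad_glN1.
by rewrite quad_mulV quad_Vmul quad_glN1.
Qed.

Lemma ker_sl2 : 'ker sl2_morphism = 'Z(SL2).
Proof.
rewrite center_SL2; apply/setP=> g; apply/idP/idP=> [kg|].
  have Gg := dom_ker kg; have {kg} /= kg := kerP _ Gg kg.
  have /and5P[_ _ _ /implyP + _] := quad_checksP (quad_in_quads Gg).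
  rewrite mem_quadN1; apply; apply/eqP; apply: codes_uniq codes1.
  by rewrite -kg; apply: codes_sl2.
case/set2P=> ->; first exact: group1.
apply/kerP=> /=; rewrite ?glN1_SL //; apply: codes_inj codes1.
suff <- : lquad (quad_GL glN1) = lone by apply/codes_sl2/glN1_SL.
by rewrite quad_glN1; vm_compute.
Qed.

(** At most 1320 quadruples occur and the kernel has order 2. The upper bound is enough: equality
    will follow from the index in M11. *)
Lemma card_sl2_image : (#|sl2_morphism @* SL2| <= 660)%N.
Proof.
have leSL : (#|SL2| <= 1320)%N.
  rewrite -size_quads cardE -(size_map quad_GL).
  apply: uniq_leq_size => [|_ /mapP[g + ->]].
    by rewrite (map_inj_uniq quad_GL_inj) enum_uniq.
  by rewrite mem_enum => /quad_in_quads.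
have ne1 : glN1 != 1.
  by rewrite -(inj_eq quad_GL_inj) quad_glN1 quad_one.
move: leSL; rewrite -(Lagrange (center_sub SL2)) card_morphim setIid ker_sl2.
have -> : #|'Z(SL2)| = 2 by rewrite center_SL2 cards2 eq_sym ne1.
by rewrite (_ : 1320 = 2 * 660)%N // leq_pmul2l.
Qed.


Lemma sl2_image : {L : {group {perm pt}} |
  [/\ L \isog SL2 / 'Z(SL2), (#|L| <= 660)%N, M11_a \in L, M11_v \in L & L \subset M11]}.
Proof.
exists (sl2_morphism @* SL2)%G; split=> /=.
(* The type of a quotient depends on its denominator, so the equality of kernel and centre is
   transported through a variable group K. *)
- rewrite isog_sym; suff: forall K : {group gT}, K :=: 'ker sl2_morphism ->
    SL2 / K \isog sl2_morphism @* SL2.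
    by move/(_ 'Z(SL2)%G); apply; rewrite ker_sl2.
  by move=> K /group_inj->; apply: first_isog.
- exact: card_sl2_image.
- by rewrite -sl2_permU; apply: mem_morphim.
- by rewrite -sl2_permV; apply: mem_morphim.
have uvuM x c y : uvu_perm x c y \in M11 by rewrite !groupM ?groupX ?M11a_in ?M11v_in.
apply/subsetP=> _ /morphimP[g _ _ ->] /=; rewrite /sl2_perm /quad_perm.
by case: ifP => _ //=; rewrite groupM // groupX ?M11v_in.
Qed.

End Morphism.

Lemma L11_sig : {L : {group {perm pt}} |
  [/\ L \isog PSL 2 'F_11, (#|L| <= 660)%N, M11_a \in L, M11_v \in L & L \subset M11]}.
Proof.
exact: sl2_image quad_GL_inj quad_in_quads glU_SL glV_SL quad_one quad_mulU
  quad_mulV quad_Umul quad_Vmul.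
Qed.

(** * The subgroup L11 and the action on its 12 cosets *)

Definition L11 := sval L11_sig.

Lemma L11P : [/\ L11 \isog PSL 2 'F_11, (#|L11| <= 660)%N, M11_a \in L11,
  M11_v \in L11 & L11 \subset M11].
Proof. exact: svalP L11_sig. Qed.

Lemma L11_sub : L11 \subset M11. Proof. by case: L11P. Qed.
Lemma L11_a : M11_a \in L11. Proof. by case: L11P. Qed.

(** As a lies in L11, it fixes the trivial coset and cycles through the eleven others, which are the
    L11 b a^k. *)
Definition coset_rep j : {perm pt} := if j is k.+1 then M11_b * M11_a ^+ k else 1.

Lemma coset_rep_in j : coset_rep j \in M11.
Proof.
case: j => [|k]; first exact: group1.
by apply: groupM; [exact: M11b_in | apply/groupX/M11a_in].
Qed.

Definition code : Type := (seq nat * seq nat)%type.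

(* [e.1] lists the images of the 11 points and [e.2] those of the 12 cosets of
   L11; the j-th coset also stands for the conjugate of L11 by [coset_rep j]. *)
Definition encodes (e : code) x :=
  [/\ codes e.1 x, size e.2 = 12 &
    forall j, j < 12 -> nth 0 e.2 j < 12 /\
      L11 :* (coset_rep j * x) = L11 :* coset_rep (nth 0 e.2 j)].

Definition cmul (e f : code) : code := (lmul e.1 f.1, lmul e.2 f.2).
Definition cone : code := (lone, iota 0 12).

Lemma encodes1 : encodes cone 1.
Proof.
split=> // [|j ltj]; first exact: codes1.
by rewrite [nth _ _ _]nth_iota // mulg1.
Qed.

Lemma encodesM e f x y : encodes e x -> encodes f y -> encodes (cmul e f) (x * y).
Proof.
case=> ex sze cx [fy szf cy]; split=> [||j ltj]; rewrite ?size_map //.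
  exact: codesM.
have [lt_ej ejx] := cx j ltj; have [lt_fej fjy] := cy _ lt_ej.
rewrite (nth_map 0) ?sze //; split=> //.
by rewrite mulgA rcosetM ejx -rcosetM.
Qed.

Lemma encodesX e x k : encodes e x -> encodes (iter k (fun f => cmul f e) cone) (x ^+ k).
Proof.
move=> ex; elim: k => [|k IHk]; first exact: encodes1.
by rewrite expgSr; apply: encodesM.
Qed.

Definition ea : code := (la, [:: 0; 2; 3; 4; 5; 6; 7; 8; 9; 10; 11; 1]%N).
Definition eb : code := (lb, [:: 1; 0; 7; 2; 11; 9; 8; 10; 5; 6; 3; 4]%N).

Lemma expa11 : M11_a ^+ 11 = 1.
Proof. by apply: codes_inj (codesX 11 codes_a) _; exact: codes1. Qed.

Lemma encodes_a : encodes ea M11_a.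
Proof.
split=> [||[|k] ltk] //; first exact: codes_a.
  by split=> //=; rewrite mul1g mulg1 rcoset_id ?L11_a.
(* The last coset returns to the first one of the cycle because a^11 = 1. *)
have [k10|] := eqVneq k 10.
  by rewrite k10 /= -mulgA -expgSr expa11 mulg1.
have -> : nth 0 ea.2 k.+1 = if k == 10 then 1%N else k.+2.
  by do 11?[case: k ltk => [|k] ltk //].
move=> k10; rewrite (negPf k10) /= expgSr mulgA; split=> //.
by change (is_true (k < 10)); rewrite ltn_neqAle k10 -ltnS.
Qed.

(* The j-th entry (x, c, y) says that r_(j+1) b = (a^x v^c a^y) r_m, where
   r_m is the coset representative prescribed by [eb]. *)
Definition coset_cocycle_b : seq (nat * nat * nat) :=
  [:: (0, 1, 9); (7, 10, 4); (3, 4, 7); (2, 6, 9); (7, 2, 9); (2, 7, 0);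
      (10, 9, 5); (4, 1, 9); (6, 8, 3); (1, 3, 9); (8, 6, 8)]%N.

Definition lcoset_rep j := if j is k.+1 then lmul lb (nth [::] lapows k) else lone.

Lemma codes_coset_rep j : j < 12 -> codes (lcoset_rep j) (coset_rep j).
Proof.
case: j => [|k] ltk /=; first exact: codes1.
by rewrite nth_mkseq //; apply: codesM codes_b _; apply/codesX/codes_a.
Qed.

Definition cocycle_check k :=
  let: (x, c, y) := nth (0, 0, 0)%N coset_cocycle_b k in
  let m := nth 0 eb.2 k.+1 in
  [&& x < 11, c < 11, y < 11, m < 12 &
    lmul (lcoset_rep k.+1) lb == lmul (luvu x c y) (lcoset_rep m)].

Lemma cocycle_checkP k : k < 11 -> cocycle_check k.
Proof.
have : all cocycle_check (iota 0 11) by vm_compute.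
by move=> /allP + ltk; apply; rewrite mem_iota.
Qed.

Lemma uvu_perm_L11 x c y : uvu_perm x c y \in L11.
Proof. by case: L11P => _ _ La Lv _; rewrite !groupM ?groupX. Qed.

Lemma encodes_b : encodes eb M11_b.
Proof.
split=> [||[|k] ltk] //; first exact: codes_b.
  by rewrite mul1g /= expg0 mulg1.
have := cocycle_checkP ltk; rewrite /cocycle_check.
case: (nth _ coset_cocycle_b k) => [[x c] y] /and5P[ltx ltc lty ltm /eqP e].
split=> //; have -> : coset_rep k.+1 * M11_b =
    uvu_perm x c y * coset_rep (nth 0 eb.2 k.+1).
  apply: codes_inj (codesM (codes_coset_rep ltk) codes_b) _.
  by rewrite e; apply: codesM (codes_uvu ltx ltc lty) (codes_coset_rep ltm).
by rewrite rcosetM rcoset_id // uvu_perm_L11.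
Qed.

(** * Enumeration of M11 *)

(* The letter 0 stands for b and the letter k > 0 for a^k. *)
Definition letter k : {perm pt} := if k is 0 then M11_b else M11_a ^+ k.
Definition cletter k : code := if k is 0 then eb else iter k (fun f => cmul f ea) cone.
Definition zword w : {perm pt} * code :=
  (foldl (fun x k => x * letter k) 1 w, foldl (fun e k => cmul e (cletter k)) cone w).

Definition sound (z : {perm pt} * code) := z.1 \in M11 /\ encodes z.2 z.1.

Lemma sound_word w : sound (zword w).
Proof.
elim/last_ind: w => [|w k [Mw ew]]; first by split; [exact: group1 | exact: encodes1].
rewrite /zword -cats1 !foldl_cat; split; rewrite /=.
  by rewrite groupM //; case: (k) => [|k']; rewrite ?groupX ?M11a_in ?M11b_in.
by apply: encodesM => //; case: (k) => [|k'];
  [apply: encodes_b | apply/encodesX/encodes_a].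
Qed.

(** [zprod] carries the permutations along for the proofs; [cprod] keeps the codes alone, which is
    what gets evaluated. *)
Definition zprod (s t : seq ({perm pt} * code)) :=
  [seq (z.1 * u.1, cmul z.2 u.2) | u <- t, z <- s].
Definition cprod (s t : seq code) := [seq cmul e f | f <- t, e <- s].

Lemma cprodE s t : map snd (zprod s t) = cprod (map snd s) (map snd t).
Proof.
rewrite /zprod /cprod map_allpairs /=.
by rewrite allpairs_mapl; congr flatten; apply: eq_map => u; rewrite -map_comp.
Qed.

Lemma sound_prod s t : {in s, forall z, sound z} -> {in t, forall z, sound z} ->
  {in zprod s t, forall z, sound z}.
Proof.
move=> s_ok t_ok _ /allpairsP[[u z] /= [/t_ok[Mu eu] /s_ok[Mz ez] ->]].
by split; [apply: groupM | apply: encodesM].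
Qed.

(* Words for a transversal, at each level i, of the stabilizer of 0, ..., i in
   the stabilizer of 0, ..., i - 1. *)
Definition ws0 : seq (seq nat) := [::] :: [seq [:: i] | i <- iota 1 10].
Definition ws1 : seq (seq nat) :=
  [:: [::]; [:: 3; 0; 2; 0]; [:: 2; 0; 5]; [:: 10; 0; 4]; [:: 1; 0; 10];
      [:: 7; 0; 9]; [:: 3; 0; 2]; [:: 8; 0; 0; 3]; [:: 4; 0; 6]; [:: 3; 0; 0; 7]]%N.
Definition ws2 : seq (seq nat) :=
  [:: [::]; [:: 6; 0; 4; 0; 2]; [:: 10; 0; 9; 0; 8]; [:: 0; 2; 0; 8; 0; 2]; [:: 0];
      [:: 0; 0; 0]; [:: 2; 0; 8; 0; 2]; [:: 4; 0; 5; 0; 4]; [:: 0; 0]]%N.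
Definition ws3 : seq (seq nat) :=
  [:: [::]; [:: 4; 0; 0; 9; 0; 10]; [:: 0; 7; 0; 10; 0; 10]; [:: 0; 4; 0; 2; 0; 9];
      [:: 8; 0; 5; 0; 9; 0; 6]; [:: 4; 0; 0; 6; 0; 7]; [:: 9; 0; 0; 8; 0; 5];
      [:: 0; 0; 4; 0; 5; 0; 4]]%N.

Definition cws w := map (fun w => (zword w).2) w.
Definition cs3 := cprod [:: cone] (cws ws3).
Definition cs2 := cprod cs3 (cws ws2).
Definition cs1 := cprod cs2 (cws ws1).
Definition cs0 := cprod cs1 (cws ws0).

Definition zs4 : seq ({perm pt} * code) := [:: (1, cone)].
Definition zs3 := zprod zs4 (map zword ws3).
Definition zs2 := zprod zs3 (map zword ws2).
Definition zs1 := zprod zs2 (map zword ws1).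
Definition zs0 := zprod zs1 (map zword ws0).

Lemma sound_words ws : {in map zword ws, forall z, sound z}.
Proof. by move=> _ /mapP[w _ ->]; apply: sound_word. Qed.

Lemma sound_zs4 : {in zs4, forall z, sound z}.
Proof. by move=> _ /predU1P[->|//]; split; [exact: group1 | exact: encodes1]. Qed.
Lemma sound_zs3 : {in zs3, forall z, sound z}.
Proof. apply: sound_prod; [exact: sound_zs4 | exact: sound_words]. Qed.
Lemma sound_zs2 : {in zs2, forall z, sound z}.
Proof. apply: sound_prod; [exact: sound_zs3 | exact: sound_words]. Qed.
Lemma sound_zs1 : {in zs1, forall z, sound z}.
Proof. apply: sound_prod; [exact: sound_zs2 | exact: sound_words]. Qed.
Lemma sound_zs0 : {in zs0, forall z, sound z}.
Proof. apply: sound_prod; [exact: sound_zs1 | exact: sound_words]. Qed.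

Lemma cs3E : map snd zs3 = cs3. Proof. by rewrite cprodE -map_comp. Qed.
Lemma cs2E : map snd zs2 = cs2. Proof. by rewrite cprodE cs3E -map_comp. Qed.
Lemma cs1E : map snd zs1 = cs1. Proof. by rewrite cprodE cs2E -map_comp. Qed.
Lemma cs0E : map snd zs0 = cs0. Proof. by rewrite cprodE cs1E -map_comp. Qed.

(** The product K U contains 1 and, since U V lies in K U, is stable under right multiplication by
    V; hence it contains the group generated by V. *)
Lemma mul_transversal_gen (gT : finGroupType) (K : {group gT}) (U V : {set gT}) :
    1 \in U -> K \subset <<V>> -> U \subset <<V>> ->
    (forall u v, u \in U -> v \in V -> u * v \in K * U) ->
  K * U = <<V>>.
Proof.
move=> U1 sKV sUV mulUV; apply/eqP; rewrite eqEsubset mul_subG //=.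
pose A := [set h | [forall x in K * U, x * h \in K * U]].
have AP h : reflect {in K * U, forall x, x * h \in K * U} (h \in A).
  by rewrite inE; apply: (iffP forall_inP).
have gsA : group_set A.
  apply/group_setP; split=> [|x y /AP Ax /AP Ay]; first by apply/AP=> x; rewrite mulg1.
  by apply/AP=> z /Ax/Ay; rewrite mulgA.
have sVA : <<V>> \subset Group gsA.
  rewrite gen_subG; apply/subsetP=> v Vv; apply/AP=> _ /mulsgP[k u Kk Uu ->].
  rewrite -mulgA; have /mulsgP[k' u' Kk' Uu' ->] := mulUV u v Uu Vv.
  by rewrite mulgA mem_mulg // groupM.
apply/subsetP=> x /(subsetP sVA)/AP/(_ 1); rewrite mul1g; apply.
by rewrite -[1]mulg1 mem_mulg ?group1.
Qed.


Lemma codesE l x i : codes l x -> i < 11 -> x (inZp i) = nth 0 l i :> nat.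
Proof. by case=> _ lx lti; rewrite lx /= modn_small. Qed.

Definition wset ws : {set {perm pt}} := [set x in [seq (zword w).1 | w <- ws]].

(** Each product u v must be some k u' with k listed in [cs]. As k is meant to fix i, comparing the
    images of i selects u' before [cs] is searched. *)
Definition level_check i (cs : seq code) (ws V : seq (seq nat)) :=
  all (fun u => all (fun v =>
    let l := lmul (zword u).2.1 (zword v).2.1 in
    has (fun f : code => (nth 0 l i == nth 0 f.1 i) &&
      has (fun e : code => lmul e.1 f.1 == l) cs) (cws ws)) V) ws.

Lemma level_gen i zs ws V (K : {group {perm pt}}) :
    K =i map fst zs -> {in zs, forall z, sound z} -> K \subset <<wset V>> ->
    [::] \in ws -> {subset ws <= V} -> level_check i (map snd zs) ws V ->
  <<wset V>> =i map fst (zprod zs (map zword ws)).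
Proof.
move=> Kzs zs_ok sKV ws1 swsV /allP chk x.
have wsetP y us : reflect (exists2 w, w \in us & y = (zword w).1) (y \in wset us).
  by rewrite inE; apply: (iffP mapP).
have sUV : wset ws \subset <<wset V>>.
  by apply: sub_gen; apply/subsetP=> y /wsetP[w /swsV Vw ->]; apply/wsetP; exists w.
rewrite -(@mul_transversal_gen _ K (wset ws)) //; first 1 last.
- by apply/wsetP; exists [::].
- move=> _ _ /wsetP[u wsu ->] /wsetP[v Vv ->].
  have /allP/(_ v Vv)/hasP[_ /mapP[u' wsu' ->]] := chk u wsu.
  case/andP=> _ /hasP[_ /mapP[z zsz ->]].
  move=> /eqP e; have [_ [zc _ _]] := zs_ok _ zsz.
  have wc w : codes (zword w).2.1 (zword w).1 by have [_ []] := sound_word w.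
  have -> : (zword u).1 * (zword v).1 = z.1 * (zword u').1.
    by apply: codes_inj (codesM (wc u) (wc v)) _; rewrite -e; apply: codesM.
  apply: mem_mulg; first by rewrite Kzs map_f.
  by apply/wsetP; exists u'.
rewrite /zprod map_allpairs /= allpairs_mapl.
apply/mulsgP/allpairsP => [[k _ Kk /wsetP[w wsw ->] ->]|[[w z] /= [wsw zsz ->]]].
  move: Kk; rewrite Kzs => /mapP[z zsz ->]; exists (w, z); split=> //.
exists z.1 (zword w).1 => //; first by rewrite Kzs map_f.
by apply/wsetP; exists w.
Qed.

Lemma codes_word w : codes (zword w).2.1 (zword w).1.
Proof. by have [_ []] := sound_word w. Qed.

Definition ws01 := ws0 ++ ws1 ++ ws2 ++ ws3.

Lemma wsetS V V' : {subset V <= V'} -> wset V \subset wset V'.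
Proof.
move=> sVV'; apply/subsetP=> x; rewrite !inE => /mapP[w Vw ->].
by apply/map_f/sVV'.
Qed.

Lemma M11_gen : <<wset ws01>> = M11.
Proof.
apply/eqP; rewrite eqEsubset !gen_subG; apply/andP; split.
  by apply/subsetP=> x; rewrite inE => /mapP[w _ ->]; have [] := sound_word w.
rewrite subUset !sub1set !mem_gen // inE; apply/mapP.
  by exists [:: 0]; rewrite //= mul1g.
by exists [:: 1%N]; rewrite //= mul1g expg1.
Qed.

Lemma level_check3 : level_check 3 [:: cone] ws3 ws3. Proof. by lazy. Qed.
Lemma level_check2 : level_check 2 cs3 ws2 (ws2 ++ ws3). Proof. by lazy. Qed.
Lemma level_check1 : level_check 1 cs2 ws1 (ws1 ++ ws2 ++ ws3). Proof. by lazy. Qed.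
Lemma level_check0 : level_check 0 cs1 ws0 ws01. Proof. by lazy. Qed.

(** The chain is climbed from the trivial group, through lists of length 8, 72, 720 and 7920; each
    level is generated by its own words and those of the deeper levels. *)
Lemma mem_M11 : M11 =i map fst zs0.
Proof.
have sub_cat (s t : seq (seq nat)) : {subset s <= s ++ t} /\ {subset t <= s ++ t}.
  by split=> w; rewrite mem_cat => ->; rewrite ?orbT.
have E3 : <<wset ws3>> =i map fst zs3.
  apply: (@level_gen 3 zs4 ws3 ws3 1%G); [|exact: sound_zs4|exact: sub1G|by []|by []|].
    by move=> x; rewrite !inE.
  exact: level_check3.
have E2 : <<wset (ws2 ++ ws3)>> =i map fst zs2.
  apply: (level_gen E3 sound_zs3); rewrite ?cs3E; [|by []| |exact: level_check2].
    by apply/genS/wsetS; case: (sub_cat ws2 ws3).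
  by case: (sub_cat ws2 ws3).
have E1 : <<wset (ws1 ++ ws2 ++ ws3)>> =i map fst zs1.
  apply: (level_gen E2 sound_zs2); rewrite ?cs2E; [|by []| |exact: level_check1].
    by apply/genS/wsetS; case: (sub_cat ws1 (ws2 ++ ws3)).
  by case: (sub_cat ws1 (ws2 ++ ws3)).
rewrite -M11_gen; apply: (level_gen E1 sound_zs1); rewrite ?cs1E;
  [|by []| |exact: level_check0].
  by apply/genS/wsetS; case: (sub_cat ws0 (ws1 ++ ws2 ++ ws3)).
by case: (sub_cat ws0 (ws1 ++ ws2 ++ ws3)).
Qed.

Lemma uniq_map_inj (T1 T2 : eqType) (f : T1 -> T2) (s : seq T1) :
  uniq (map f s) -> {in s &, injective f}.
Proof.
elim: s => //= a s IHs /andP[fa Us] x y; rewrite !inE.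
case/predU1P=> [->|sx] /predU1P[->|sy] // e; last exact: IHs.
- by case/negP: fa; rewrite e map_f.
by case/negP: fa; rewrite -e map_f.
Qed.

(** The elements of [zs] fix i, so the image of i under a product determines its word, and
    cancelling the word determines the other factor. *)
Lemma uniq_zprod i zs ws : i < 11 -> uniq (map fst zs) -> {in zs, forall z, sound z} ->
    all (fun e : code => nth 0 e.1 i == i) (map snd zs) ->
    uniq [seq nth 0 e.1 i | e : code <- cws ws] ->
  uniq (map fst (zprod zs (map zword ws))).
Proof.
move=> lti Uzs zs_ok /allP fix_i Uws; rewrite /zprod map_allpairs allpairs_mapl.
have Uws' : uniq [seq (zword w).1 (inZp i) | w <- ws].
  rewrite -(map_inj_uniq val_inj) -map_comp; apply: etrans Uws; congr uniq.
  by rewrite -map_comp; apply: eq_map => w; apply: codesE (codes_word w) lti.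
apply: allpairs_uniq; [exact: map_uniq Uws' | exact: map_uniq Uzs |].
have fix_z z : z \in zs -> z.1 (inZp i) = inZp i.
  move=> zsz; have [_ [zc _ _]] := zs_ok z zsz; apply: val_inj.
  by rewrite /= (codesE zc lti) (eqP (fix_i _ (map_f _ zsz))) modn_small.
move=> _ _ /allpairsP[[w z] /= [wsw zsz ->]] /allpairsP[[w' z'] /= [wsw' zsz' ->]] /= e.
have eqw : w = w'.
  apply: (uniq_map_inj Uws') => //; have := congr1 (fun x : {perm pt} => x (inZp i)) e.
  by rewrite /= !permM (fix_z _ zsz) (fix_z _ zsz'); apply.
by rewrite -eqw in e *; rewrite (uniq_map_inj Uzs zsz zsz' (mulIg _ _ _ e)).
Qed.

Lemma M11_enum_uniq : uniq (map fst zs0).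
Proof.
apply: (@uniq_zprod 0); [by []| |exact: sound_zs1 | by rewrite cs1E; lazy | by lazy].
apply: (@uniq_zprod 1); [by []| |exact: sound_zs2 | by rewrite cs2E; lazy | by lazy].
apply: (@uniq_zprod 2); [by []| |exact: sound_zs3 | by rewrite cs3E; lazy | by lazy].
by apply: (@uniq_zprod 3); [by [] | by [] | exact: sound_zs4 | lazy | lazy].
Qed.

(** All counts in M11 pass through this: a property that can be read off the codes is counted on the
    list [cs0]. *)
Lemma card_M11_sub (D : pred {perm pt}) (Q : pred code) :
    (forall e x, x \in M11 -> encodes e x -> D x = Q e) ->
  #|[set x in M11 | D x]| = count Q cs0.
Proof.
move=> DQ; transitivity (count D (map fst zs0)).
  rewrite -size_filter -(card_uniqP (filter_uniq _ M11_enum_uniq)).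
  by apply: eq_card => x; rewrite inE mem_filter mem_M11 andbC.
rewrite -cs0E !count_map; apply: eq_in_count => z /sound_zs0[Mz ez] /=.
exact: DQ.
Qed.

(** * Orders of M11 and L11, and the conjugates of L11 *)

Lemma card_M11 : #|M11| = 7920.
Proof.
transitivity (size cs0); last by rewrite !size_allpairs.
rewrite -(count_predT cs0) -(@card_M11_sub predT) //.
by apply: eq_card => x; rewrite inE andbT.
Qed.

Lemma M11_code x : x \in M11 -> exists2 e, e \in cs0 & encodes e x.
Proof.
rewrite mem_M11 => /mapP[z zz ->]; exists z.2; first by rewrite -cs0E map_f.
by have [] := sound_zs0 zz.
Qed.

Lemma code_M11 e : e \in cs0 -> exists2 x, x \in M11 & encodes e x.
Proof.
by rewrite -cs0E => /mapP[z /sound_zs0[Mz ez] ->]; exists z.1.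
Qed.

Lemma rcosets_L11 : rcosets L11 M11 = [set L11 :* coset_rep j | j : 'I_12].
Proof.
apply/setP=> A; apply/rcosetsP/imsetP => [[x Mx ->]|[j _ ->]]; last first.
  by exists (coset_rep j); rewrite ?coset_rep_in.
have [e _ [_ _ /(_ 0 isT)[lte]]] := M11_code Mx.
by rewrite mul1g => ->; exists (Ordinal lte).
Qed.

(** The order is at most 660, the index at most 12, and their product is 7920 = 660 * 12. *)
Lemma card_L11 : #|L11| = 660.
Proof.
have [_ leL _ _ sLM] := L11P; apply/eqP; rewrite eqn_leq leL /=.
have : #|M11 : L11| <= 12.
  by rewrite /indexg rcosets_L11 (leq_trans (leq_imset_card _ _)) ?card_ord.
rewrite -(leq_pmul2l (cardG_gt0 L11)) Lagrange // card_M11.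
by rewrite (_ : 7920 = 660 * 12)%N // leq_pmul2r.
Qed.

Lemma index_L11 : #|M11 : L11| = 12.
Proof. by rewrite -divgS ?L11_sub // card_M11 card_L11. Qed.

(** Twelve representatives account for all cosets and the index is 12, so no two of them agree. *)
Lemma coset_rep_inj j k : j < 12 -> k < 12 ->
  L11 :* coset_rep j = L11 :* coset_rep k -> j = k.
Proof.
move=> ltj ltk e.
have /imset_injP inj : #|[set L11 :* coset_rep j | j : 'I_12]| == #|'I_12|.
  by rewrite -rcosets_L11 card_ord -/(indexg M11 L11) index_L11.
by have [] := inj (Ordinal ltj) (Ordinal ltk) isT isT e.
Qed.

Lemma mem_L11_conj e x j : x \in M11 -> encodes e x -> j < 12 ->
  (x \in L11 :^ coset_rep j) = (nth 0 e.2 j == j).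
Proof.
move=> Mx [_ _ ex] ltj; have [lt_ej ej] := ex j ltj.
rewrite mem_conjg conjgE invgK mulgA -mem_rcoset; apply/idP/eqP => [Lx|fix_j].
  by apply: (coset_rep_inj lt_ej ltj); rewrite -ej; apply/rcoset_eqP.
by apply/rcoset_eqP; rewrite ej fix_j.
Qed.


(** * Maximal subgroups containing an element of order 11 *)

Definition lcodes_in (H : {group {perm pt}}) l := exists2 x, x \in H & codes l x.

(* The power of a on the right is chosen to bring the image of 0 back to 0. *)
Definition lnorm l := lmul l (nth [::] lapows ((11 - nth 0 l 0) %% 11)).
(** A hit puts an element of the double coset of [l] with respect to the group generated by a into
    [T]. *)
Definition lhits (T : seq (seq nat)) l :=
  has (fun k => lnorm (lmul (nth [::] lapows k) l) \in T) (iota 0 11).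
Definition lword l i j :=
  lmul (lmul (lmul (lmul l (nth [::] lapows i)) l) (nth [::] lapows j)) l.
Definition lreaches (T : seq (seq nat)) l :=
  has (fun i => has (fun j => lhits T (lword l i j)) (iota 0 11)) (iota 0 11).

Definition lgen l := forall H : {group {perm pt}},
  M11_a \in H -> lcodes_in H l -> M11_b \in H.

Lemma lcodes_in_a (H : {group {perm pt}}) k : M11_a \in H -> k < 11 ->
  lcodes_in H (nth [::] lapows k).
Proof.
move=> Ha ltk; exists (M11_a ^+ k); first exact: groupX.
by rewrite nth_mkseq //; apply/codesX/codes_a.
Qed.

Lemma lcodes_inM (H : {group {perm pt}}) l m :
  lcodes_in H l -> lcodes_in H m -> lcodes_in H (lmul l m).
Proof.
by case=> x Hx lx [y Hy my]; exists (x * y); [apply: groupM | apply: codesM].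
Qed.

Lemma lhits_gen T l : {in T, forall m, lgen m} -> lhits T l -> lgen l.
Proof.
move=> genT /hasP[k]; rewrite mem_iota => /= ltk /genT gen_l H Ha Hl.
apply: gen_l => //; do 2?[apply: lcodes_inM] => //; apply: lcodes_in_a => //.
by rewrite ltn_mod.
Qed.

Lemma lreaches_gen T l : {in T, forall m, lgen m} -> lreaches T l -> lgen l.
Proof.
move=> genT /hasP[i + /hasP[j]]; rewrite !mem_iota => /= lti ltj.
move/(lhits_gen genT) => gen_w H Ha Hl; apply: gen_w => //.
by do 4?[apply: lcodes_inM] => //; apply: lcodes_in_a.
Qed.

(** Elements outside L11, normalised by a power of a on the right so as to fix the point 0. *)
Definition outer :=
  [seq e.1 | e : code <- cs0 & (nth 0 e.1 0 == 0) && (nth 0 e.2 0 != 0)].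

(* One element of each double coset of <a> outside L11. *)
Definition outer_reps :=
  foldl (fun T l => if lhits T l then T else l :: T) [::] outer.

(** Two rounds suffice: these representatives produce b by one word [lword], and each of the others
    produces one of these up to powers of a. *)
Definition outer_good := [seq l <- outer_reps | lreaches [:: lb] l].

Lemma outer_good_check :
  all (fun l => lreaches outer_good l || (l \in outer_good)) outer_reps.
Proof. by lazy. Qed.

Lemma outer_reps_check : all (lhits outer_reps) outer.
Proof. by lazy. Qed.

Lemma outer_gen l : l \in outer -> lgen l.
Proof.
have gen_b : {in [:: lb], forall m, lgen m}.
  move=> _ /predU1P[->|//] H _ [y Hy yb].
  by rewrite -(codes_inj yb codes_b).
have gen_good : {in outer_good, forall m, lgen m}.
  by move=> m; rewrite mem_filter => /andP[/(lreaches_gen gen_b)].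
have gen_reps : {in outer_reps, forall m, lgen m}.
  by move=> m /(allP outer_good_check)/orP[/(lreaches_gen gen_good)|/gen_good].
by move/(allP outer_reps_check)/(lhits_gen gen_reps).
Qed.

Lemma mem_L11 e x : x \in M11 -> encodes e x -> (x \in L11) = (nth 0 e.2 0 == 0).
Proof. by move=> Mx ex; rewrite -(mem_L11_conj Mx ex) // conjsg1. Qed.

Lemma M11_gen_outer (H : {group {perm pt}}) x :
  H \subset M11 -> M11_a \in H -> x \in H -> x \notin L11 -> H :=: M11.
Proof.
move=> sHM Ha Hx L'x; have Mx := subsetP sHM x Hx.
(* This power of a brings the image of 0 back to 0; multiplying by it affects neither membership in
   H nor membership in L11. *)
pose y := x * M11_a ^+ ((11 - x (inZp 0)) %% 11).
have Hy : y \in H by rewrite groupM ?groupX.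
have My := subsetP sHM y Hy; have [e cs_e ey] := M11_code My.
have L'y : nth 0 e.2 0 != 0.
  by rewrite -(mem_L11 My ey) groupMr ?groupX ?L11_a.
have y0 : nth 0 e.1 0 = 0.
  have [ye _ _] := ey; rewrite -(codesE ye) // permM.
  have [_ ->] := codesX ((11 - x (inZp 0)) %% 11) codes_a.
  have /allP rot0 : all (fun i => nth 0 (lpow la ((11 - i) %% 11)) i == 0) (iota 0 11).
    by vm_compute.
  by apply/eqP/rot0; rewrite mem_iota; apply: ltn_ord.
have out_e : e.1 \in outer.
  by apply/mapP; exists e; rewrite // mem_filter y0 L'y cs_e.
have Hb : M11_b \in H.
  by apply: (outer_gen out_e Ha); exists y => //; case: ey.
by apply/eqP; rewrite eqEsubset sHM gen_subG subUset !sub1set Ha Hb.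
Qed.

(** A subgroup containing a is either M11 or contained in L11, which yields both maximality and
    uniqueness. *)
Lemma max_over_a : max_over M11 M11_a = [set L11].
Proof.
have neL : M11 \subset L11 = false.
  by apply/negP=> /subset_leq_card; rewrite card_M11 card_L11.
have outerP (H : {group {perm pt}}) : H \subset M11 -> M11_a \in H ->
    ~~ (H \subset L11) -> H :=: M11.
  by move=> sHM Ha /subsetPn[x Hx L'x]; apply: M11_gen_outer Hx L'x.
have maxL : maximal L11 M11.
  apply/maxgroupP; split=> [|H ltHM sLH]; first by rewrite properE L11_sub neL.
  apply/eqP; rewrite eqEsubset sLH andbT; have sHM := proper_sub ltHM.
  apply: contraTT ltHM => nHL.
  by rewrite (outerP H sHM (subsetP sLH _ L11_a) nHL) properxx.
apply/setP=> M; rewrite !inE; apply/andP/eqP=> [[maxM Ma]|->]; last by rewrite L11_a.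
have [ltMM eqM] := maxgroupP maxM.
apply/group_inj/esym; apply: eqM; first by rewrite properE L11_sub neL.
have sMM := proper_sub ltMM.
by apply: contraTT ltMM => nML; rewrite (outerP M sMM Ma nML) properxx.
Qed.

Lemma Sylow11_order11 s : s \in M11 -> #[s] = 11 -> 11.-Sylow(M11) <[s]>.
Proof.
by move=> Ms s11; rewrite pHallE cycle_subG Ms -orderE s11 card_M11 p_part.
Qed.

Lemma order_a : #[M11_a] = 11.
Proof.
apply: nt_prime_order; rewrite ?expa11 //; apply/eqP=> a1.
by have [_ /(_ (inZp 0))] := codes_a; rewrite a1 perm1.
Qed.

(** The cyclic group of s is a Sylow 11-subgroup, hence conjugate to that of a, and maximal
    overgroups depend only on the cyclic group. *)
Lemma max_over_order11 s : s \in M11 -> #[s] = 11 ->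
  exists2 x, x \in M11 & max_over M11 (s ^ x) = [set L11].
Proof.
move=> Ms s11; have [x Mx e] := Sylow_trans (Sylow11_order11 Ms s11)
  (Sylow11_order11 M11a_in order_a).
by exists x; rewrite // -max_over_a; apply: eq_max_over; rewrite e cycleJ.
Qed.

(** * Fixed cosets and the values 1/3 for elements of order 11 *)

Definition fix12 (e : code) := [seq j <- iota 0 12 | nth 0 e.2 j == j].

Lemma perm_char_L11 e x : x \in M11 -> encodes e x ->
  perm_char M11 L11 x = size (fix12 e).
Proof.
move=> Mx ex; have -> : size (fix12 e) = #|[set j : 'I_12 | nth 0 e.2 j == j]|.
  rewrite cardE /enum_mem size_filter -enumT /fix12 size_filter -val_enum_ord count_map.
  by apply: eq_count => j; rewrite /= in_set.
rewrite /perm_char.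
have -> : 'Fix_(rcosets L11 M11 | 'Rs)[x] =
    (fun j : 'I_12 => L11 :* coset_rep j) @: [set j : 'I_12 | nth 0 e.2 j == j].
  apply/setP=> A; rewrite rcosets_L11; have [_ _ cx] := ex.
  apply/setIP/imsetP=> [[/imsetP[j _ ->] /afix1P]|[j]].
    rewrite /= rcosetE -rcosetM; have [ltj ->] := cx j (ltn_ord j) => ej.
    by exists j; rewrite // in_set; apply/eqP/(coset_rep_inj ltj (ltn_ord j)).
  rewrite in_set => /eqP fixj ->; split; first exact: imset_f.
  apply/afix1P; rewrite /= rcosetE -rcosetM.
  by have [_ ->] := cx j (ltn_ord j); rewrite fixj.
apply: card_imset => j k /coset_rep_inj e_jk.
by apply: val_inj; apply: e_jk; apply: ltn_ord.
Qed.

Lemma fix12_check : all (fun e : code => (e.1 == lone) || (size (fix12 e) <= 4)) cs0.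
Proof. by lazy. Qed.

Lemma encodes_lone e x : encodes e x -> (e.1 == lone) = (x == 1).
Proof.
case=> ex _ _; apply/eqP/eqP=> [e1|x1].
  by apply: codes_inj codes1; rewrite -e1.
by apply: codes_uniq ex _; rewrite x1; apply: codes1.
Qed.

Lemma perm_char_L11_le x : x \in M11^# -> perm_char M11 L11 x <= 4.
Proof.
case/setD1P=> x1 Mx; have [e /(allP fix12_check) + ex] := M11_code Mx.
by rewrite (encodes_lone ex) (negPf x1) (perm_char_L11 Mx ex).
Qed.

Definition M11_t := (zword [:: 0; 0]).1.
Definition ct := (zword [:: 0; 0]).2.

Lemma M11t_in : M11_t \in M11. Proof. by have [] := sound_word [:: 0; 0]. Qed.
Lemma encodes_t : encodes ct M11_t. Proof. by have [] := sound_word [:: 0; 0]. Qed.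
Lemma M11t_in1 : M11_t \in M11^#.
Proof. by rewrite !inE M11t_in andbT -(encodes_lone encodes_t). Qed.

Lemma M11_D1_neq0 : M11^# != set0.
Proof. by apply/set0Pn; exists M11_t; apply: M11t_in1. Qed.

Lemma P_elt_order11 s g : s \in M11 -> #[s] = 11 -> g \in M11 ->
  P_elt M11 g s = ((perm_char M11 L11 g)%:R / 12%:R)%R.
Proof.
move=> Ms s11 Mg; have [x Mx maxs] := max_over_order11 Ms s11.
by rewrite -(P_eltJ _ _ Mx) (P_elt_unique_maximal maxs) ?groupJ ?index_L11.
Qed.

Lemma max_over_order11_conj s : s \in M11 -> #[s] = 11 ->
  exists2 x, x \in M11 & max_over M11 s = [set (L11 :^ x)%G].
Proof.
move=> Ms s11; have [x Mx maxs] := max_over_order11 Ms s11.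
exists x^-1; rewrite ?groupV // -[s](conjgK x) max_over_conj ?groupV // maxs.
exact: imset_set1.
Qed.

Lemma sigma_elt_order11 s g : s \in M11 -> #[s] = 11 -> g \in M11 ->
  sigma_elt M11 g s = P_elt M11 g s.
Proof.
move=> Ms s11 Mg; have [x Mx maxs] := max_over_order11_conj Ms s11.
by rewrite (sigma_elt_unique_maximal _ maxs) (P_elt_unique_maximal maxs).
Qed.

(** Serves both P and sigma: a nontrivial element fixes at most 4 of the 12 cosets, and t fixes
    exactly 4. *)
Lemma max_order11 (f : {perm pt} -> rat) s : s \in M11 -> #[s] = 11 ->
    (forall g, g \in M11 -> f g = P_elt M11 g s) ->
  maxval M11^# f = (1 / 3%:R)%R.
Proof.
move=> Ms s11 fE; have [[g /setD1P[g1 Mg] fg] fmax] := maxvalP f M11_D1_neq0.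
have Ef h : h \in M11 -> f h = ((perm_char M11 L11 h)%:R / 12%:R)%R.
  by move=> Mh; rewrite fE // P_elt_order11.
have third : (4%:R / 12%:R = 1 / 3%:R :> rat)%R by apply/eqP.
have pt4 : perm_char M11 L11 M11_t = 4 by rewrite (perm_char_L11 M11t_in encodes_t).
apply/eqP; rewrite eq_le -third; apply/andP; split.
  rewrite fg Ef // ler_pM2r // ler_nat perm_char_L11_le //.
  by rewrite !inE g1.
by apply: le_trans (fmax _ M11t_in1); rewrite Ef ?M11t_in // pt4.
Qed.

Lemma P_at_order11 s : s \in M11 -> #[s] = 11 -> P_at M11 s = (1 / 3%:R)%R.
Proof. by move=> Ms s11; apply: (max_order11 Ms s11). Qed.

Lemma sigma_at_order11 s : s \in M11 -> #[s] = 11 -> sigma_at M11 s = (1 / 3%:R)%R.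
Proof.
move=> Ms s11; apply: max_order11 (Ms) (s11) _ => g.
exact: sigma_elt_order11.
Qed.

(** * Elements of other orders *)

Definition pstable (x : {perm pt}) (s : seq nat) :=
  all (fun i => val (x (inZp i)) \in s) s.
Definition lstable (l s : seq nat) := all (fun i => nth 0 l i \in s) s.

Definition points (s : seq nat) := all (fun i => i < 11) s.

Lemma pstableE l x s : codes l x -> points s -> pstable x s = lstable l s.
Proof.
move=> lx /allP lts; apply: eq_in_all => i /lts lti.
by rewrite -(codesE lx lti).
Qed.

Definition pimg (x : {perm pt}) (s : seq nat) := [seq val (x (inZp i)) | i <- s].

Lemma points_img x s : points (pimg x s).
Proof. by apply/allP=> _ /mapP[i _ ->]; apply: ltn_ord. Qed.

Lemma pstableJ x z s : pstable x s -> pstable (x ^ z) (pimg z s).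
Proof.
move/allP=> xs; apply/allP=> _ /mapP[i si ->].
rewrite valZpK permJ; apply/mapP; exists (val (x (inZp i))); first exact: xs.
by rewrite valZpK.
Qed.

(** An invariant set of M11 is invariant under the translation a, so it is empty or contains all 11
    points. *)
Lemma pstable_nongen s x y : 0 < size s < 11 -> pstable x s -> pstable y s ->
  points s -> <<[set x; y]>> != M11.
Proof.
move=> /andP[s_gt0 s_lt11] xs ys /allP pts.
pose Y := [set i : pt | val i \in s].
have stabP z : pstable z s -> z \in 'N(Y | 'P).
  move/allP=> zs; rewrite !inE; apply/subsetP=> i; rewrite !inE => si /=.
  by have := zs _ si; rewrite valZpK.
apply/eqP=> gen; have: M11_a \in 'N(Y | 'P).
  have /subsetP : M11 \subset 'N(Y | 'P).
    by rewrite -gen gen_subG subUset !sub1set !stabP.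
  by apply; exact: M11a_in.
move=> Na; have Yadd k i : i \in Y -> (i + k%:R)%R \in Y.
  move=> Yi; elim: k => [|k IHk]; first by rewrite addr0.
  rewrite mulrSr addrA; have := astabs_act ((i + k%:R)%R : pt) Na.
  by rewrite /= apermE permE IHk.
have [i0 Yi0] : exists i0, i0 \in Y.
  case: s s_gt0 pts @Y stabP {xs ys s_lt11 gen Na Yadd} => // j s _ pts Y _.
  by exists (inZp j); rewrite inE /= modn_small ?mem_head // pts ?mem_head.
have YT i : i \in Y.
  by have := Yadd (i - i0)%R _ Yi0; rewrite natr_Zp addrCA subrr addr0.
move: s_lt11; rewrite ltnNge => /negP[].
rewrite -[11](size_iota 0) uniq_leq_size ?iota_uniq // => i.
rewrite mem_iota => /= lti; have := YT (Ordinal lti); by rewrite inE.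
Qed.

(** The product w v u sends 0, 1, 2 to u(0), u(v(1)), u(v(w(2))), because v fixes 0 and w fixes 0
    and 1. *)
Lemma triple_transitive_check :
  all (fun p => all (fun q => all (fun r => uniq [:: p; q; r] ==>
    has (fun u : code => (nth 0 u.1 0 == p) &&
    has (fun v : code => (nth 0 u.1 (nth 0 v.1 1%N) == q) &&
    has (fun w : code => nth 0 u.1 (nth 0 v.1 (nth 0 w.1 2)) == r)
     (cws ws2)) (cws ws1)) (cws ws0))
    (iota 0 11)) (iota 0 11)) (iota 0 11) &&
  all (fun v : code => nth 0 v.1 0 == 0) (cws ws1) &&
  all (fun w : code => (nth 0 w.1 0 == 0) && (nth 0 w.1 1%N == 1%N)) (cws ws2).
Proof. by lazy. Qed.

Lemma triple_transitive p q r : p < 11 -> q < 11 -> r < 11 -> uniq [:: p; q; r] ->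
  exists2 z, z \in M11 & pimg z [:: 0; 1; 2]%N = [:: p; q; r].
Proof.
move=> ltp ltq ltr Upqr; have /andP[/andP[]] := triple_transitive_check.
have mem11 i : i < 11 -> i \in iota 0 11 by rewrite mem_iota.
move=> /allP/(_ p (mem11 _ ltp))/allP/(_ q (mem11 _ ltq))/allP/(_ r (mem11 _ ltr)).
rewrite Upqr => /hasP[_ /mapP[u _ ->] /andP[/eqP up]].
case/hasP=> _ /mapP[v ws_v ->] /andP[/eqP uvq] /hasP[_ /mapP[w ws_w ->] /eqP uvwr].
move=> /allP/(_ _ (map_f _ ws_v))/eqP v0 /allP/(_ _ (map_f _ ws_w))/andP[/eqP w0 /eqP w1].
exists ((zword w).1 * (zword v).1 * (zword u).1).
  have inM z : (zword z).1 \in M11 by have [] := sound_word z.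
  by do 2?apply: groupM; apply: inM.
have Euvw i : i < 11 -> val (((zword w).1 * (zword v).1 * (zword u).1) (inZp i)) =
    nth 0 (zword u).2.1 (nth 0 (zword v).2.1 (nth 0 (zword w).2.1 i)).
  move=> lti; rewrite 2!permM.
  have [[_ eu] [_ ev]] := (codes_word u, codes_word v).
  apply: etrans (eu _) _; congr nth; apply: etrans (ev _) _; congr nth.
  exact: codesE (codes_word w) lti.
by rewrite /pimg /= !Euvw // w0 w1 v0 up uvq uvwr.
Qed.

(* A fixed point and a disjoint invariant pair, as for elements of order 8. *)
Definition has_flag (l : seq nat) :=
  has (fun p => lstable l [:: p] && has (fun q => has (fun r =>
    lstable l [:: q; r] && uniq [:: p; q; r])
  (iota 0 11)) (iota 0 11)) (iota 0 11).

(* A fixed coset and a second fixed coset or an invariant pair: the first alone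
   only gives P(t, s) >= 1/3, the second makes it strict. *)
Definition two_structures (e : code) :=
  has (fun j => (nth 0 e.2 j == j) &&
    (has (fun k => (k != j) && (nth 0 e.2 k == k)) (iota 0 12) ||
     has (fun q => has (fun r => lstable e.1 [:: q; r] && (q != r))
       (iota 0 11)) (iota 0 11)))
  (iota 0 12).

(** Asking for a fixed coset as well lets [structure_check] also serve the spread: every element
    fixes a coset or has a flag. *)
Definition code_order11 (e : code) :=
  (0 < size (fix12 e)) && (lpow e.1 11 == lone).

Lemma structure_check :
  all (fun e : code => [|| two_structures e, has_flag e.1 | code_order11 e]) cs0.
Proof. by lazy. Qed.

(* Here 2640 is a third of 7920; the count is (183 / 495) 7920 = 2928. *)
Lemma flag_check :
  2640 < count (fun e : code => lstable ct.1 [:: nth 0 e.1 0]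
    || lstable ct.1 [:: nth 0 e.1 1%N; nth 0 e.1 2]) cs0.
Proof. by vm_compute. Qed.

(** Coset j is sent to each of the 12 cosets by 660 elements, and t fixes 4 of them. One fixed coset
    of s thus yields a proportion of exactly 1/3. *)
Lemma coset_count_check :
  all (fun j =>
    count (fun e : code => let k := nth 0 e.2 j in nth 0 ct.2 k == k) cs0 == 2640)
    (iota 0 12).
Proof. by vm_compute. Qed.

(** Supplies one bad element not yet counted through coset j: t moves the image of j but fixes the
    image of k. The next check does the same with a pair of points. *)
Lemma two_cosets_check :
  all (fun j => all (fun k => (k != j) ==>
    has (fun e : code => (nth 0 ct.2 (nth 0 e.2 j) != nth 0 e.2 j) &&
      (nth 0 ct.2 (nth 0 e.2 k) == nth 0 e.2 k)) cs0)
  (iota 0 12)) (iota 0 12).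
Proof. by lazy. Qed.

Lemma coset_pair_check :
  all (fun j => all (fun q => all (fun r => (q != r) ==>
    has (fun e : code => (nth 0 ct.2 (nth 0 e.2 j) != nth 0 e.2 j) &&
      lstable ct.1 [:: nth 0 e.1 q; nth 0 e.1 r]) cs0)
  (iota 0 11)) (iota 0 11)) (iota 0 12).
Proof. by lazy. Qed.

Lemma third_lt m n : 0 < n -> n < m -> (1 / 3%:R < m%:R / (3 * n)%:R :> rat)%R.
Proof.
move=> n_gt0 ltnm; rewrite natrM invfM mulrCA mul1r ltr_pMr ?invr_gt0 ?ltr0n //.
by rewrite ltr_pdivlMr ?ltr0n // mul1r ltr_nat.
Qed.

Lemma P_elt_gt_third s g :
    2640 < #|[set h in M11 | <<[set s ^ h; g]>> != M11]| ->
  (1 / 3%:R < P_elt M11 g s)%R.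
Proof.
move=> lt_bad; rewrite /P_elt card_M11 (_ : 7920 = 3 * 2640)%N; last by vm_compute.
exact: third_lt lt_bad.
Qed.

(** Triple transitivity and the invariance of P under conjugation of s reduce to the flag {0}, {1,
    2}, for which [flag_check] counts the h moving a part of it to a set invariant under t. *)
Lemma flag_nongen s p q r : s \in M11 ->
    p < 11 -> q < 11 -> r < 11 -> uniq [:: p; q; r] ->
    pstable s [:: p] -> pstable s [:: q; r] ->
  (1 / 3%:R < P_elt M11 M11_t s)%R.
Proof.
move=> Ms ltp ltq ltr Upqr sp sqr.
have [z Mz] := triple_transitive ltp ltq ltr Upqr.
case=> z0 z1 z2; have zV i j : z (inZp i) = j :> nat -> i < 11 -> z^-1 (inZp j) = inZp i.
  by move=> <- lti; rewrite valZpK permK.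
rewrite -(P_eltJ _ _ (groupVr Mz)); apply: P_elt_gt_third.
set s' := s ^ z^-1.
have s'0 : pstable s' [:: 0].
  by have := pstableJ z^-1 sp; rewrite /pimg /= (zV 0).
have s'12 : pstable s' [:: 1; 2]%N.
  by have := pstableJ z^-1 sqr; rewrite /pimg /= (zV 1%N) // (zV 2).
pose D (h : {perm pt}) := pstable M11_t (pimg h [:: 0]) ||
  pstable M11_t (pimg h [:: 1; 2]%N).
apply: leq_trans flag_check _; rewrite -(@card_M11_sub D); last first.
  move=> e h Mh [eh _ _]; have [tc _ _] := encodes_t.
  rewrite /D !(pstableE tc) ?points_img //= /pimg /=.
  by rewrite !(codesE eh).
apply/subset_leq_card/subsetP=> h; rewrite !inE => /andP[Mh Dh]; rewrite Mh /=.
case/orP: Dh => Dh; apply: pstable_nongen Dh (points_img _ _) => //.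
  exact: pstableJ.
exact: pstableJ.
Qed.

Lemma coset_L11_conj g h j e : g \in M11 -> encodes e h -> j < 12 -> 
  (g \in L11 :^ (coset_rep j * h)) = (g \in L11 :^ coset_rep (nth 0 e.2 j)).
Proof.
move=> Mg [_ _ eh] ltj; have [_ ehj] := eh j ltj.
have [l Ll ->] : exists2 l, l \in L11 & coset_rep j * h = l * coset_rep (nth 0 e.2 j).
  by apply/rcosetP; rewrite -ehj rcoset_refl.
by rewrite conjsgM (conjGid Ll).
Qed.

Lemma L11_nongen j s g h e : j < 12 -> s \in L11 :^ coset_rep j -> g \in M11 ->
    h \in M11 -> encodes e h -> g \in L11 :^ coset_rep (nth 0 e.2 j) ->
  <<[set s ^ h; g]>> != M11.
Proof.
move=> ltj sL Mg Mh eh gL.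
apply: (@sub_nongen _ M11 (L11 :^ (coset_rep j * h))%G).
- have Mjh : coset_rep j * h \in M11 by rewrite groupM ?coset_rep_in.
  by rewrite properEcard /= cardJg card_L11 card_M11 conj_subG ?L11_sub.
- by rewrite /= conjsgM memJ_conjg.
by rewrite /= (coset_L11_conj Mg eh).
Qed.

(** Coset j accounts for 2640 bad elements, a third of the group, and h1 is one more. *)
Lemma coset_nongen s j h1 e1 : s \in M11 -> j < 12 -> s \in L11 :^ coset_rep j ->
    h1 \in M11 -> encodes e1 h1 ->
    nth 0 ct.2 (nth 0 e1.2 j) != nth 0 e1.2 j -> <<[set s ^ h1; M11_t]>> != M11 ->
  (1 / 3%:R < P_elt M11 M11_t s)%R.
Proof.
move=> Ms ltj sL Mh1 eh1 nfix1 bad1; apply: P_elt_gt_third.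
pose D (h : {perm pt}) := M11_t \in L11 :^ (coset_rep j * h).
have DE e h : h \in M11 -> encodes e h ->
    D h = (let k := nth 0 e.2 j in nth 0 ct.2 k == k).
  move=> Mh eh; rewrite /D (coset_L11_conj M11t_in eh) //.
  by rewrite (mem_L11_conj M11t_in encodes_t) //; have [_ _ /(_ j ltj)[]] := eh.
have cardD : #|[set h in M11 | D h]| = 2640.
  rewrite (@card_M11_sub D (fun e => let k := nth 0 e.2 j in nth 0 ct.2 k == k)).
    by apply/eqP; apply: (allP coset_count_check); rewrite mem_iota.
  by move=> e x; apply: DE.
have nD1 : h1 \notin [set h in M11 | D h].
  by rewrite inE Mh1 (DE _ _ Mh1 eh1).
apply: leq_trans (_ : #|h1 |: [set h in M11 | D h]| <= _).
  by rewrite cardsU1 nD1 cardD add1n leqnn.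
apply/subset_leq_card/subsetP=> h /setU1P[->|]; first by rewrite inE Mh1.
rewrite !inE => /andP[Mh Dh]; rewrite Mh /=; have [e _ eh] := M11_code Mh.
apply: (L11_nongen ltj sL M11t_in Mh eh).
by rewrite -(coset_L11_conj M11t_in eh).
Qed.

Lemma has_flagP l : has_flag l -> exists p q r,
  [/\ p < 11, q < 11, r < 11, uniq [:: p; q; r] &
      lstable l [:: p] && lstable l [:: q; r]].
Proof.
case/hasP=> p + /andP[lp /hasP[q + /hasP[r + /andP[lqr U]]]].
by rewrite !mem_iota => ltp ltq ltr; exists p, q, r; split; rewrite ?lp.
Qed.

Lemma two_structures_nongen s e : s \in M11 -> encodes e s -> two_structures e ->
  (1 / 3%:R < P_elt M11 M11_t s)%R.
Proof.
move=> Ms es /hasP[j iota_j /andP[fixj two]]; have := iota_j; rewrite mem_iota => /= ltj.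
have sLj : s \in L11 :^ coset_rep j by rewrite (mem_L11_conj Ms es).
case/orP: two => [/hasP[k iota_k /andP[nkj fixk]]|
    /hasP[q iota_q /hasP[r iota_r /andP[eqr nqr]]]].
  have /hasP[e1 cs_e1 /andP[nfix1 fix1]] :=
    implyP (allP (allP two_cosets_check j iota_j) k iota_k) nkj.
  have [h1 Mh1 eh1] := code_M11 cs_e1; apply: (coset_nongen Ms ltj sLj Mh1 eh1 nfix1).
  move: iota_k; rewrite mem_iota => /= ltk.
  apply: (L11_nongen ltk _ M11t_in Mh1 eh1); first by rewrite (mem_L11_conj Ms es).
  by rewrite (mem_L11_conj M11t_in encodes_t) //; have [_ _ /(_ k ltk)[]] := eh1.
have /hasP[e1 cs_e1 /andP[nfix1 fix1]] :=
  implyP (allP (allP (allP coset_pair_check j iota_j) q iota_q) r iota_r) nqr.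
have [h1 Mh1 eh1] := code_M11 cs_e1; apply: (coset_nongen Ms ltj sLj Mh1 eh1 nfix1).
move: iota_q iota_r; rewrite !mem_iota => /= ltq ltr.
have [[ec _ _] [tc _ _] [hc _ _]] := And3 es encodes_t eh1.
have stab_s : pstable s [:: q; r] by rewrite (pstableE ec) //= /points /= ltq ltr.
apply: pstable_nongen (pstableJ h1 stab_s) _ (points_img _ _) => //.
rewrite (pstableE tc) ?points_img //.
by move: fix1; rewrite /pimg /= !(codesE hc).
Qed.

Lemma P_elt_other_order s : s \in M11^# -> #[s] != 11 ->
  (1 / 3%:R < P_elt M11 M11_t s)%R.
Proof.
case/setD1P=> s1 Ms s11; have [e cs_e es] := M11_code Ms; have [ec _ _] := es.
case/or3P: (allP structure_check e cs_e) => [|/has_flagP|/andP[_ /eqP e11]].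
- exact: two_structures_nongen.
- move=> [p [q [r [ltp ltq ltr Upqr /andP[ep eqr]]]]].
  by apply: (flag_nongen Ms ltp ltq ltr Upqr);
    rewrite (pstableE ec) //= /points /= ?ltp ?ltq ?ltr.
case/eqP: s11; apply: nt_prime_order => //.
by apply: codes_inj (codesX 11 ec) _; rewrite e11; apply: codes1.
Qed.

Lemma P_at_gt s : s \in M11^# -> #[s] != 11 -> (1 / 3%:R < P_at M11 s)%R.
Proof.
move=> Ms s11; apply: lt_le_trans (P_elt_other_order Ms s11) _.
by have [_] := maxvalP (fun g => P_elt M11 g s) M11_D1_neq0; apply; apply: M11t_in1.
Qed.

Lemma sigma_at_gt s : s \in M11^# -> #[s] != 11 -> (1 / 3%:R < sigma_at M11 s)%R.
Proof.
move=> Ms s11; apply: lt_le_trans (P_elt_other_order Ms s11) _.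
apply: le_trans (P_le_sigma _ M11t_in) _; first by case/setD1P: Ms.
by have [_] := maxvalP (fun g => sigma_elt M11 g s) M11_D1_neq0; apply; apply: M11t_in1.
Qed.

(** Applied to both [sigma_at] and [P_at]. *)
Lemma third_iff (f : {perm pt} -> rat) :
    (forall s, s \in M11 -> #[s] = 11 -> f s = (1 / 3%:R)%R) ->
    (forall s, s \in M11^# -> #[s] != 11 -> (1 / 3%:R < f s)%R) ->
  minval M11^# f = (1 / 3%:R)%R /\
  forall s, s \in M11^# -> (f s = (1 / 3%:R)%R <-> #[s] = 11).
Proof.
move=> f11 f_gt; have Ma1 : M11_a \in M11^#.
  by rewrite !inE M11a_in andbT -order_eq1 order_a.
split=> [|s Ms]; last first.
  split=> [fs|]; last by apply: f11; case/setD1P: Ms.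
  by apply/eqP; apply: contraT => /(f_gt s Ms); rewrite fs ltxx.
have [[s Ms fs] fmin] := minvalP f M11_D1_neq0.
apply/eqP; rewrite eq_le -{1}(f11 _ M11a_in order_a) fmin //= fs.
have [s11|s11] := eqVneq #[s] 11; last exact: ltW (f_gt s Ms s11).
by rewrite f11 //; case/setD1P: Ms.
Qed.

(** * Spread *)

Definition fours := [seq m <- map fix12 cs0 | size m == 4].

(** Three fixed sets of at most 4 elements can cover the 12 cosets only as a partition into 4-sets,
    and this rules such a partition out. *)
Lemma fours_check : all (fun m => all (fun n => has (mem m) n ||
  ([seq j <- iota 0 12 | j \notin m ++ n] \notin fours)) fours) fours.
Proof. by lazy. Qed.

Lemma three_fixed_sets e1 e2 e3 :
    e1 \in cs0 -> e2 \in cs0 -> e3 \in cs0 ->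
    size (fix12 e1) <= 4 -> size (fix12 e2) <= 4 -> size (fix12 e3) <= 4 ->
  exists2 j, j < 12 & {in [:: e1; e2; e3], forall e, nth 0 e.2 j != j}.
Proof.
move=> c1 c2 c3 le1 le2 le3.
have [/hasP[j]|] := boolP (has (fun j =>
  j \notin fix12 e1 ++ fix12 e2 ++ fix12 e3) (iota 0 12)).
  move=> iota_j; rewrite !mem_cat !negb_or !mem_filter iota_j !andbT => /and3P[f1 f2 f3].
  exists j; first by rewrite mem_iota in iota_j.
  by move=> e; rewrite !inE => /or3P[]/eqP->.
rewrite -all_predC => /allP cover.
have {}cover : {subset iota 0 12 <= fix12 e1 ++ fix12 e2 ++ fix12 e3}.
  by move=> j /cover; rewrite /= negbK.
(* Covering 12 cosets with at most 4 + 4 + 4 forces every size to be 4 and the sets to be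
   disjoint. *)
have := uniq_leq_size (iota_uniq 0 12) cover; rewrite size_iota !size_cat => ge12.
have le12 : size (fix12 e1 ++ fix12 e2 ++ fix12 e3) <= 12.
  by rewrite !size_cat (leq_add le1 (leq_add le2 le3)).
have sz1 : size (fix12 e1) = 4.
  apply/eqP; rewrite eqn_leq le1 -(leq_add2r 8) (leq_trans ge12) // leq_add2l.
  exact: leq_add le2 le3.
have sz2 : size (fix12 e2) = 4.
  apply/eqP; rewrite eqn_leq le2 -(leq_add2l 4) -(leq_add2r 4).
  by rewrite (leq_trans ge12) // sz1 addnA leq_add2l.
have sz3 : size (fix12 e3) = 4.
  by apply/eqP; rewrite eqn_leq le3 -(leq_add2l 8) (leq_trans ge12) // sz1 sz2.
have four e : e \in cs0 -> size (fix12 e) = 4 -> fix12 e \in fours.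
  by move=> cs_e sz; rewrite mem_filter sz map_f.
have U : uniq (fix12 e1 ++ fix12 e2 ++ fix12 e3).
  by apply: leq_size_uniq (iota_uniq 0 12) cover _; rewrite size_iota.
have := allP (allP fours_check _ (four _ c1 sz1)) _ (four _ c2 sz2).
rewrite catA cat_uniq in U; case/and3P: U => U12 /hasPn U3 _.
have -> : has (mem (fix12 e1)) (fix12 e2) = false.
  by move: U12; rewrite cat_uniq => /and3P[_ /negPf].
rewrite orFb (_ : [seq _ <- _ | _] = fix12 e3) ?four //.
apply: eq_in_filter => j iota_j.
have -> : (nth 0 e3.2 j == j) = (j \in fix12 e3) by rewrite mem_filter iota_j andbT.
apply/idP/idP=> [nf12|f3]; last exact: U3.
by have := cover j iota_j; rewrite catA mem_cat (negPf nf12).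
Qed.

(** Take a coset j fixed by none of the three elements and the conjugate of s whose only maximal
    overgroup is L11 conjugated by [coset_rep j]; none of the three lies in that overgroup. *)
Lemma spread3_order11 s : s \in M11 -> #[s] = 11 -> spread_within M11 (s ^: M11) 3.
Proof.
move=> Ms s11 g g_ok; have [x Mx maxs] := max_over_order11 Ms s11.
have code_g i : exists e, [/\ e \in cs0, encodes e (g i) & size (fix12 e) <= 4].
  have Mgi := subsetP (subD1set _ _) _ (g_ok i); have [e cs_e eg] := M11_code Mgi.
  by exists e; split=> //; rewrite -(perm_char_L11 Mgi eg) perm_char_L11_le.
have [e0 [cs_e0 eg0 le0]] := code_g (@Ordinal 3 0 isT).
have [e1 [cs_e1 eg1 le1]] := code_g (@Ordinal 3 1 isT).
have [e2 [cs_e2 eg2 le2]] := code_g (@Ordinal 3 2 isT).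
have [j ltj nfix] := three_fixed_sets cs_e0 cs_e1 cs_e2 le0 le1 le2.
exists (s ^ (x * coset_rep j)); first by rewrite memJ_class ?groupM ?coset_rep_in.
move=> i; have Mgi := subsetP (subD1set _ _) _ (g_ok i).
apply/eqP; rewrite setUC conjgM -[_ == _]negbK.
rewrite (nongen_unique_maximal maxs) ?groupJ ?coset_rep_in //.
have [e ee eg] : exists2 e, e \in [:: e0; e1; e2] & encodes e (g i).
  case: i {Mgi} => [[|[|[|//]]] lti]; rewrite (bool_irrelevance lti isT);
    [exists e0 | exists e1 | exists e2]; by rewrite // !inE eqxx ?orbT.
by rewrite (mem_L11_conj Mgi eg ltj) nfix.
Qed.

(** The first word is the square of a^5 b and the third is t; the last gives the element of order
    3. *)
Definition spread4_words : seq (seq nat) :=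
  [:: [:: 5; 0; 5; 0]; [:: 0; 2; 0; 4; 0; 3]; [:: 0; 0]; [:: 3; 0; 4]]%N.

(** Every coset is fixed by one of the four elements, and every flag has a part, or the union of its
    parts, invariant under one of them. *)
Lemma spread4_check :
  all (fun j => has (fun e : code => nth 0 e.2 j == j) (cws spread4_words)) (iota 0 12) &&
  all (fun p => all (fun q => all (fun r => uniq [:: p; q; r] ==>
    has (fun e : code => [|| lstable e.1 [:: p], lstable e.1 [:: q; r] |
      lstable e.1 [:: p; q; r]]) (cws spread4_words))
    (iota 0 11)) (iota 0 11)) (iota 0 11) &&
  all (fun e : code => e.1 != lone) (cws spread4_words).
Proof. by lazy. Qed.

Lemma not_spread4 : ~ spread_at_least M11 4.
Proof.
case/andP: spread4_check => /andP[/allP fix_chk /allP flag_chk] /allP ne1.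
pose g (i : 'I_4) := (zword (nth [::] spread4_words i)).1.
case/(_ g) => [i|s Ms gen].
  have [Mi ei] := sound_word (nth [::] spread4_words i).
  rewrite !inE Mi andbT -(encodes_lone ei).
  have iw : nth [::] spread4_words i \in spread4_words by apply/mem_nth/ltn_ord.
  exact: ne1 _ (map_f (fun w => (zword w).2) iw).
have {}gen w : w \in spread4_words -> <<[set s; (zword w).1]>> = M11.
  case/(nthP [::])=> i lti <-; rewrite setUC; exact: gen (Ordinal lti).
have [e cs_e es] := M11_code Ms; have [ec _ _] := es.
have fixF j : j < 12 -> nth 0 e.2 j != j.
  move=> ltj; apply/negP=> fixj.
  have /hasP[_ /mapP[w ww ->] fixw] :
      has (fun e : code => nth 0 e.2 j == j) (cws spread4_words).
    by apply: fix_chk; rewrite mem_iota.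
  have [Mw ew] := sound_word w; have := gen w ww; apply/eqP.
  rewrite -[s]conjg1; apply: (L11_nongen ltj _ Mw (group1 _) encodes1).
    by rewrite (mem_L11_conj Ms es).
  by rewrite nth_iota // (mem_L11_conj Mw ew).
case/or3P: (allP structure_check e cs_e) => [/hasP[j + /andP[fixj _]]|/has_flagP|].
- by rewrite mem_iota => /= /fixF; rewrite fixj.
- move=> [p [q [r [ltp ltq ltr Upqr /andP[ep eqr]]]]].
  have mem11 i : i < 11 -> i \in iota 0 11 by rewrite mem_iota.
  have /hasP[_ /mapP[w ww ->] stab_w] :=
    implyP (allP (allP (flag_chk p (mem11 _ ltp)) q (mem11 _ ltq)) r (mem11 _ ltr)) Upqr.
  have wc := codes_word w.
  have no Y : 0 < size Y < 11 -> points Y -> lstable e.1 Y ->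
      lstable (zword w).2.1 Y -> False.
    move=> szY ptsY; rewrite -(pstableE ec ptsY) -(pstableE wc ptsY) => sY wY.
    by have := pstable_nongen szY sY wY ptsY; rewrite gen ?eqxx.
  case/or3P: stab_w; apply: no; rewrite // /points /= ?ltp ?ltq ?ltr //.
  (* The union of the fixed point and the invariant pair is invariant under s too. *)
  apply/allP=> i; rewrite inE => /predU1P[->|iqr].
    by have := allP ep p (mem_head _ _); rewrite !inE => ->.
  by have := allP eqr i iqr; rewrite !inE => ->; rewrite orbT.
rewrite /code_order11 -has_predT => /andP[/hasP[j + _] _].
by rewrite mem_filter mem_iota => /andP[fixj /= /fixF]; rewrite fixj.
Qed.

Theorem mainTheorem8 :
  (sigma M11 = (1 / 3%:R)%R /\
   (forall s, s \in M11^# -> (sigma_at M11 s = (1 / 3%:R)%R <-> #[s] = 11))) /\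
  (forall s, s \in M11 -> #[s] = 11 ->
     exists2 M, max_over M11 s = [set M] & M \isog PSL 2 'F_11) /\
  (P M11 = (1 / 3%:R)%R /\
   (forall s, s \in M11^# -> (P_at M11 s = (1 / 3%:R)%R <-> #[s] = 11))) /\
  (uniform_spread_exactly M11 3 /\
   spread_exactly M11 3 /\
   (forall s, s \in M11 -> #[s] = 11 ->
      spread_within M11 (s ^: M11) 3)).
Proof.
have unif3 : uniform_spread_at_least M11 3.
  exists (M11_a ^: M11); first by rewrite mem_classes ?M11a_in.
  exact: spread3_order11 M11a_in order_a.
split; first exact: third_iff sigma_at_order11 sigma_at_gt.
split=> [s Ms s11|].
  have [x Mx maxs] := max_over_order11_conj Ms s11; exists (L11 :^ x)%G => //.
  have [isoL _ _ _ _] := L11P; apply: isog_trans isoL.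
  by rewrite isog_sym; apply: conj_isog.
split; first exact: third_iff P_at_order11 P_at_gt.
split; first by split=> // /spread_of_uniform/not_spread4.
split; first by split; [apply: spread_of_uniform | apply: not_spread4].
exact: spread3_order11.
Qed.
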